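(* For every $d\in\mathbb{N}$ there exists an explicit construction of an infinite sequence $\mathcal{S}_d=(\boldsymbol{x}_k)_{k\ge 0}$ of points in $[0,1)^d$ (a single sequence, independent of $p$ and $N$) with the following property: for every real $p$ with $1\le p<\infty$ there is a constant $C_{p,d}>0$, depending only on $p$ and $d$, such that $$L_{p,N}(\mathcal{S}_d)\le C_{p,d}\,\frac{(\log N)^{d/2}}{N}\qquad\text{for all integers } N\ge 2 .$$
   Context: $\mathbb{N}=\{1,2,3,\dots\}$, $\mathbb{N}_0=\mathbb{N}\cup\{0\}$. **Discrepancy.** For a sequence $\mathcal{S}_d=(\boldsymbol{x}_k)_{k\ge0}$ in $[0,1)^d$ and $N\in\mathbb{N}$, the discrepancy function of the first $N$ terms is $$D_{\mathcal{S}_d}^N(\boldsymbol{x})=\frac1N\sum_{k=0}^{N-1}\chi_{[\boldsymbol 0,\boldsymbol x)}(\boldsymbol{x}_k)-x_1\cdots x_d,\qquad \boldsymbol{x}=(x_1,\dots,x_d)\in[0,1]^d,$$ where $[\boldsymbol 0,\boldsymbol x)=[0,x_1)\times\cdots\times[0,x_d)$ and $\chi_A$ is the characteristic function of $A$. The $L_p$-discrepancy is $L_{p,N}(\mathcal{S}_d)=\left(\int_{[0,1]^d}|D_{\mathcal{S}_d}^N(\boldsymbol{x})|^p\,d\boldsymbol{x}\right)^{1/p}$ for $1\le p<\infty$. **The explicit construction meant.** Put $s=2d$. Let $p_1=x\in\mathbb{F}_2[x]$, and for $j=2,\dots,s$ let $p_j$ be the $(j-1)$-th polynomial in a list of all irreducible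 polynomials over $\mathbb{F}_2$ other than $x$, sorted by non-decreasing degree (the order among equal degrees is irrelevant); let $e_j=\deg p_j$. For $j\in\{1,\dots,s\}$ and $k\in\mathbb{N}$ write $k-1=(i-1)e_j+z$ with $i\ge1$ and $0\le z<e_j$, expand $$\frac{x^{e_j-z-1}}{p_j(x)^i}=\sum_{\ell=1}^\infty a_\ell(i,j,z)x^{-\ell}\in\mathbb{F}_2((x^{-1})),$$ and set $c_{j,k,\ell}=a_\ell(i,j,z)$, $C_j=(c_{j,k,\ell})_{k,\ell\ge1}\in\mathbb{F}_2^{\mathbb{N}\times\mathbb{N}}$. With $\vec c_{j,k}$ the $k$-th row of $C_j$, define (interlacing) matrices $E_1,\dots,E_d\in\mathbb{F}_2^{\mathbb{N}\times\mathbb{N}}$ whose rows are $\vec e_{j,2u+v}=\vec c_{2(j-1)+v,\,u+1}$ for $1\le j\le d$, $u\in\mathbb{N}_0$, $v\in\{1,2\}$. The sequence $\mathcal{S}_d$ is the digital sequence over $\mathbb{F}_2$ with generating matrices $E_1,\dots,E_d$: for $k\in\mathbb{N}_0$ with binary expansion $k=k_0+k_1 2+k_2 2^2+\cdots$ put $\vec k=(k_0,k_1,k_2,\dots)^\top\in\mathbb{F}_2^{\mathbb{N}}$, compute $E_j\vec k=(x_{j,k,1},x_{j,k,2},\dots)^\top$ over $\mathbb{F}_2$ (identified with $\{0,1\}$), set $x_{j,k}=\sum_{i\ge1}x_{j,k,i}2^{-i}$ and $\boldsymbol{x}_k=(x_{1,k},\dots,x_{d,k})$. *)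

(* Defs.v *)
From HB Require Import structures.
From mathcomp Require Import all_boot all_order all_algebra.
From mathcomp Require Import all_classical all_reals all_analysis.

Set Implicit Arguments.
Unset Strict Implicit.
Unset Printing Implicit Defensive.
Import Order.TTheory GRing.Theory Num.Theory.
Import numFieldNormedType.Exports.

Local Open Scope classical_set_scope.
Local Open Scope ring_scope.

(* The coefficient of x^n in the expansion of f / g in F((x^-1)).  For l : nat
   the quotient (f * 'X^l) %/ g is the polynomial part of x^l f / g, so its
   constant term is the coefficient of x^-l; laurent_coefP says that g times
   the resulting series is f. *)
Definition laurent_coef (F : fieldType) (f g : {poly F}) (n : int) : F :=
  match n with
  | Posz m => (f %/ g)`_m
  | Negz l => ((f * 'X^(l.+1)) %/ g)`_0
  end.

Lemma coef_divp_shift (F : fieldType) (f g : {poly F}) (l m j : nat) :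
  g != 0 -> ((f * 'X^(l + m)) %/ g)`_(j + m) = ((f * 'X^l) %/ g)`_j.
Proof.
move=> g0; rewrite exprD mulrA {1}(divp_eq (f * 'X^l) g) mulrDl.
rewrite mulrAC divpD mulpK // coefD coefMXn ltnNge leq_addl /= addnK.
rewrite [X in _ + X]nth_default ?addr0 //.
rewrite size_divp //.
set r := (f * 'X^l) %% g.
have [->|r0] := eqVneq r 0; first by rewrite mul0r size_poly0 sub0n.
have := ltn_modp (f * 'X^l) g; rewrite -/r g0 => rg.
rewrite size_mulXn // leq_subLR; apply: (@leq_trans (m + (size g).-1)).
  by rewrite leq_add2l -ltnS prednK // size_poly_gt0.
by rewrite addnC leq_add2l leq_addl.
Qed.

Lemma laurent_coefE (F : fieldType) (f g : {poly F}) (M j : nat) :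
  g != 0 -> ((f * 'X^M) %/ g)`_j = laurent_coef f g (j%:Z - M%:Z).
Proof.
move=> g0; have [Mj|jM] := leqP M j.
  rewrite subzn //= -[in LHS](subnK Mj) -{1}[M]add0n coef_divp_shift //.
  by rewrite expr0 mulr1.
have -> : (j%:Z - M%:Z) = Negz (M - j).-1.
  by rewrite NegzE prednK ?subn_gt0 // -subzn 1?ltnW // opprB.
rewrite /laurent_coef prednK ?subn_gt0 //.
by rewrite -{1}(subnK (ltnW jM)) -[X in _`_X = _]add0n coef_divp_shift.
Qed.

Lemma laurent_coefP (F : fieldType) (f g : {poly F}) (n : int) : g != 0 ->
  \sum_(i < size g) g`_i * laurent_coef f g (n - i%:Z) =
  if n is Posz m then f`_m else 0.
Proof.
move=> g0; pose M := (`|n|%N + size g)%N.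
have [k nE kM] : exists2 k : nat, n = k%:Z - M%:Z & (size g <= k)%N.
  case: n @M => [m|l] M.
    exists (m + M)%N; first by rewrite PoszD addrK.
    by rewrite /M addnA leq_addl.
  exists (size g); last by [].
  by rewrite /M /= PoszD opprD addrCA subrr addr0 NegzE.
have kE : (f * 'X^M)`_k = if n is Posz m then f`_m else 0.
  rewrite coefMXn nE; have [Mk|kM'] := leqP M k; first by rewrite subzn.
  have -> // : (k%:Z - M%:Z) = Negz (M - k).-1.
  by rewrite NegzE prednK ?subn_gt0 // -subzn 1?ltnW // opprB.
rewrite -kE (divp_eq (f * 'X^M) g) coefD [X in _ + X]nth_default ?addr0; last first.
  by apply: leq_trans kM; apply: ltnW; rewrite ltn_modp.
rewrite mulrC coefM.
have shiftE (i : 'I_(size g)) :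
    laurent_coef f g (n - i%:Z) = ((f * 'X^M) %/ g)`_(k - i).
  rewrite laurent_coefE // -subzn; last by apply: leq_trans kM; exact: ltnW.
  by rewrite nE addrAC.
under eq_bigr do rewrite shiftE.
rewrite (big_ord_widen k.+1 (fun i => g`_i * (f * 'X^M %/ g)`_(k - i))).
  rewrite big_mkcond; apply: eq_bigr => i _; case: ltnP => // gi.
  by rewrite nth_default // mul0r.
exact: leqW.
Qed.

Definition irreducible_enumeration (q : nat -> {poly 'F_2}) : Prop :=
  [/\ injective q,
      forall f : {poly 'F_2},
        (irreducible_poly f /\ f <> 'X) <-> exists j, q j = f
    & {homo q : i j / (i <= j)%N >-> (size i <= size j)%N}].

(* All indices of coordinates, rows and columns are shifted to start at 0:
   base_poly q j is p_(j+1) and niederreiter q j k l is c_(j+1, k+1, l+1). *)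
Definition base_poly (q : nat -> {poly 'F_2}) (j : nat) : {poly 'F_2} :=
  if j is i.+1 then q i else 'X.

Definition niederreiter (q : nat -> {poly 'F_2}) (j k l : nat) : 'F_2 :=
  let p := base_poly q j in
  let e := (size p).-1 in
  laurent_coef 'X^(e - k %% e - 1) (p ^+ (k %/ e).+1) (- l.+1%:Z).

Definition interlace (C : nat -> nat -> nat -> 'F_2) (j r l : nat) : 'F_2 :=
  C (2 * j + r %% 2)%N (r %/ 2)%N l.

Definition binary_digit (k l : nat) : nat := ((k %/ 2 ^ l) %% 2)%N.

(* The entry i of E * (k_0, k_1, ...)^T; the digits k_l with l >= k vanish
   because k < 2 ^ k. *)
Definition digit_vector (E : nat -> nat -> 'F_2) (k i : nat) : 'F_2 :=
  \sum_(l < k) E i l * (binary_digit k l)%:R.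

Definition digital_sequence (R : realType) (d : nat)
    (E : nat -> nat -> nat -> 'F_2) (k : nat) : d.-tuple R :=
  [tuple limn (series (fun i : nat =>
     (digit_vector (E j) k i : nat)%:R / 2 ^+ i.+1 : R)) | j < d].

Definition explicit_sequence (R : realType) (d : nat)
    (q : nat -> {poly 'F_2}) : nat -> d.-tuple R :=
  digital_sequence R d (interlace (niederreiter q)).

Section lebesgue_measure_tuple.
Variable R : realType.
Local Notation RR := (measurableTypeR R).

Definition cons_pair (n : nat) (z : RR * n.-tuple RR) : n.+1.-tuple RR :=
  [tuple of z.1 :: z.2].

Lemma measurable_cons_pair n : measurable_fun setT (@cons_pair n).
Proof. by apply: measurable_cons; [exact: measurable_fst|exact: measurable_snd]. Qed.

Section step.
Variables (n : nat) (m : {sigma_finite_measure set (n.-tuple RR) -> \bar R}).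

Definition lebesgue_cons : set (n.+1.-tuple RR) -> \bar R :=
  pushforward (@lebesgue_measure R \x m)%E (@cons_pair n).

Let lebesgue_cons0 : lebesgue_cons set0 = 0%E.
Proof. by rewrite /lebesgue_cons /pushforward preimage_set0 measure0. Qed.

Let lebesgue_cons_ge0 A : (0 <= lebesgue_cons A)%E.
Proof. by apply: integral_ge0 => x _; exact: measure_ge0. Qed.

Let lebesgue_cons_sigma_additive : semi_sigma_additive lebesgue_cons.
Proof.
move=> F mF tF mUF; rewrite /lebesgue_cons /pushforward preimage_bigcup.
apply: measure_semi_sigma_additive.
- by move=> i; rewrite -[X in measurable X]setTI; exact: measurable_cons_pair.
- apply/trivIsetP => i j _ _ ij; rewrite -preimage_setI.
  by move/trivIsetP : tF => /(_ _ _ _ _ ij) ->//; rewrite preimage_set0.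
- rewrite -preimage_bigcup -[X in measurable X]setTI.
  exact: measurable_cons_pair.
Qed.

HB.instance Definition _ := isMeasure.Build _ _ _ lebesgue_cons
  lebesgue_cons0 lebesgue_cons_ge0 lebesgue_cons_sigma_additive.

Lemma lebesgue_cons_sigma_finite : sigma_finite setT lebesgue_cons.
Proof.
have /sigma_finiteP[F [TF ndF Foo]] := sigma_finiteT (@lebesgue_measure R).
have /sigma_finiteP[G [TG ndG Goo]] := sigma_finiteT m.
pose uncons (t : n.+1.-tuple RR) := (thead t, [tuple of behead t] : n.-tuple RR).
have consK : cancel (@cons_pair n) uncons.
  by case=> x t; rewrite /uncons /= theadE; congr pair; apply: val_inj.
have muncons : measurable_fun setT uncons.
  apply/measurable_fun_pairP; split => /=.
    exact: measurable_tnth.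
  exact: measurable_behead.
exists (fun i => uncons @^-1` (F i `*` G i)).
  rewrite predeqE => t; split => // _.
  have [i _ Fi] : (\bigcup_i F i) (thead t) by rewrite -TF.
  have [j _ Gj] : (\bigcup_i G i) [tuple of behead t] by rewrite -TG.
  exists (maxn i j) => //; split.
    by move: Fi; exact/subsetPset/ndF/leq_maxl.
  by move: Gj; exact/subsetPset/ndG/leq_maxr.
move=> i; have [mF Foo_i] := Foo i; have [mG Goo_i] := Goo i; split.
  by rewrite -[X in measurable X]setTI; apply: muncons => //; exact: measurableX.
rewrite /lebesgue_cons /pushforward -comp_preimage.
rewrite (_ : uncons \o _ = id); last by apply/funext => z; exact: consK.
by rewrite preimage_id product_measure1E // lte_mul_pinfty // ge0_fin_numE.
Qed.

HB.instance Definition _ :=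
  Measure_isSigmaFinite.Build _ _ _ lebesgue_cons lebesgue_cons_sigma_finite.

End step.

Fixpoint lebesgue_tuple (n : nat) :
    {sigma_finite_measure set (n.-tuple RR) -> \bar R} :=
  match n with
  | 0 => \d_([tuple] : 0.-tuple RR)
  | n'.+1 => lebesgue_cons (lebesgue_tuple n')
  end.

Lemma lebesgue_tuple_box n (A : 'I_n -> set RR) :
  (forall i, measurable (A i)) ->
  lebesgue_tuple n [set x | forall i, A i (tnth x i)] =
  (\prod_(i < n) lebesgue_measure (A i))%E.
Proof.
elim: n A => [|n IH] A mA.
  by rewrite big_ord0 /= diracE mem_set // => -[].
rewrite big_ord_recl -IH //= /lebesgue_cons /pushforward.
rewrite -product_measure1E //=; last first.
  rewrite (_ : [set x | _] =
      \big[setI/setT]_(i < n) ((@tnth n RR)^~ i @^-1` A (lift ord0 i))).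
    apply: bigsetI_measurable => i _; rewrite -[X in measurable X]setTI.
    exact: measurable_tnth.
  rewrite -bigcap_seq; apply/seteqP; split => x /= h i => [_|]; first exact: h.
  by apply: h => /=; rewrite mem_index_enum.
congr (_ _); apply/seteqP; split => -[x t] /=.
  move=> h; split; first exact: (h ord0).
  by move=> i; have := h (lift ord0 i); rewrite tnthS.
by move=> [h0 h] i; case: (unliftP ord0 i) => [j|] ->; rewrite ?tnthS.
Qed.

End lebesgue_measure_tuple.

Definition anchored_box (R : realType) (d : nat) (x : d.-tuple R) :
    set (d.-tuple R) :=
  [set y | forall i, 0 <= tnth y i < tnth x i].

Definition unit_cube (R : realType) (d : nat) : set (d.-tuple R) :=
  [set x | forall i, 0 <= tnth x i <= 1].

Definition discrepancy (R : realType) (d : nat) (S : nat -> d.-tuple R)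
    (N : nat) (x : d.-tuple R) : R :=
  N%:R^-1 * (\sum_(k < N) \1_(anchored_box x) (S k)) - \prod_(i < d) tnth x i.

Definition Lp_discrepancy (R : realType) (d : nat) (p : R)
    (S : nat -> d.-tuple R) (N : nat) : \bar R :=
  ((\int[lebesgue_tuple R d]_(x in @unit_cube R d)
      (`|discrepancy S N x| `^ p)%:E) `^ p^-1)%E.

(* Main.v *)
Require Import Defs.
From HB Require Import structures.
From mathcomp Require Import all_boot all_order all_algebra.
From mathcomp Require Import all_classical all_reals all_analysis.
From mathcomp Require Import measurable_realfun.
From mathcomp Require Import zify ring lra.

Set Implicit Arguments.
Unset Strict Implicit.
Unset Printing Implicit Defensive.
Import Order.TTheory GRing.Theory Num.Theory.
Import numFieldNormedType.Exports.

Local Open Scope classical_set_scope.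
Local Open Scope ring_scope.

(* Fix N <= 2^n and replace the cube by the dyadic grid of mesh 2^-L, L = 2 n;
   this changes N times the discrepancy by at most d.  As a function of the
   binary digits of a, the indicator of y <= a is a sum of martingale differences
   level j a y, j <= L, so the discrepancy on the grid is a sum of (L + 1)^d terms,
   each of which is odd under the flip of one digit of each coordinate and even
   under the flips of the later digits.  Such sums satisfy, for p = 2 m, the
   inequality ||sum f_j||_p^2 <= C sum ||f_j||_p^2, obtained by adding the levels
   one at a time: ||f + g||_p^2 <= ||f||_p^2 + C ||g||_p^2 when g is odd and f even.
   Hence it is enough to bound each term by a constant, uniformly in j and N.
   Up to a sign, a term sums over the points in a dyadic box of volume 2^-r a
   product of tent functions, and the tent function is the sum over m of
   2^-(m+1) (y_(j-1) xor y_(j+m)).  In an aligned block of 2^mu points the digits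
   of E_i with indices below j_i and the digit j_i + m_i are independent unless
   sum_i (2 j_i + m_i) > 2 mu - O(1): these rows of E_i are among the first j_i / 2
   rows of one Niederreiter matrix and the first (j_i + m_i) / 2 rows of another,
   up to O(1).  So the error of a block decays geometrically in mu - r, and the
   blocks of the binary expansion of N contribute O(1) in total. *)

(** * Independence of the rows of the Niederreiter matrices *)

Section niederreiter_rows.
Variable F : fieldType.
Implicit Types f g p : {poly F}.

Lemma laurent_coefD f1 f2 g n :
  laurent_coef (f1 + f2) g n = laurent_coef f1 g n + laurent_coef f2 g n.
Proof. by case: n => m /=; rewrite ?mulrDl divpD coefD. Qed.

Lemma laurent_coefZ c f g n :
  laurent_coef (c *: f) g n = c * laurent_coef f g n.
Proof. by case: n => m /=; rewrite -?scalerAl divpZl coefZ. Qed.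

Lemma laurent_coef0 g n : laurent_coef 0 g n = 0.
Proof. by rewrite -[X in laurent_coef X](scale0r 0) laurent_coefZ mul0r. Qed.

Lemma laurent_coef_sum (I : Type) (s : seq I) (P : pred I) (f : I -> {poly F})
    g n :
  laurent_coef (\sum_(i <- s | P i) f i) g n =
  \sum_(i <- s | P i) laurent_coef (f i) g n.
Proof.
apply: (big_morph (fun f => laurent_coef f g n)); last exact: laurent_coef0.
by move=> f1 f2; exact: laurent_coefD.
Qed.

Lemma laurent_coefMr f g h n : g != 0 -> h != 0 ->
  laurent_coef (f * h) (g * h) n = laurent_coef f g n.
Proof.
by move=> g0 h0; case: n => m /=; rewrite ?[f * h * _]mulrAC divp_pmul2r.
Qed.

(** By [laurent_coefP] each coefficient of [f] is a convolution of [g] with the expansion of f / g.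
    That expansion has no polynomial part, and only its first deg [g] fractional coefficients
    enter. *)
Lemma laurent_coef_eq0 f g m : g != 0 -> (size f < size g)%N ->
  ((size g).-1 <= m)%N ->
  (forall l, (l < m)%N -> laurent_coef f g (- l.+1%:Z) = 0) -> f = 0.
Proof.
move=> g0 fg gm f0; apply/polyP => k; rewrite coef0.
have /= <- := laurent_coefP f (Posz k) g0; apply: big1 => i _.
have [ik|ki] := leqP i k; first by rewrite subzn //= divp_small // coef0 mulr0.
have -> : Posz k - i%:Z = - (i - k).-1.+1%:Z.
  by rewrite prednK ?subn_gt0 // -subzn 1?ltnW // opprB.
rewrite f0 ?mulr0 //; apply: leq_trans gm; move: ki (ltn_ord i).
by case: (nat_of_ord i) => // j _ ji; case: (size g) ji => [//|sg] ji; lia.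
Qed.

Lemma size_exp_neq0 p n : p != 0 -> size (p ^+ n) = ((size p).-1 * n).+1.
Proof. by move=> p0; rewrite -size_exp prednK // size_poly_gt0 expf_neq0. Qed.

(** The entry of [niederreiter] with its base polynomial replaced by any polynomial over any
    field. *)
Definition row_coef p (k l : nat) : F :=
  let e := (size p).-1 in
  laurent_coef 'X^(e - k %% e - 1) (p ^+ (k %/ e).+1) (- l.+1%:Z).

(** The fraction of row [k] has degree -(k + 1), so its expansion starts in column [k]: the matrices
    are upper triangular. *)
Lemma row_coef_eq0 p k l : (1 < size p)%N -> (l < k)%N -> row_coef p k l = 0.
Proof.
move=> p1 lk; rewrite /row_coef -NegzE /= -exprD divp_small ?coef0 //.
rewrite size_polyXn size_exp_neq0 -?size_poly_gt0 ?(ltn_trans _ p1) //=.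
set e := (size p).-1; have e0 : (0 < e)%N by rewrite /e; lia.
have := ltn_pmod k e0; have := divn_eq k e; set z := (k %% e)%N.
by rewrite mulnSr; lia.
Qed.

(** Strong induction: once the earlier coefficients vanish, only the term [k] reaches the leading
    degree of [B k]. *)
Lemma sum_decreasing_size_eq0 (D : nat) (a : nat -> F) (B : nat -> {poly F}) :
  (forall k, (k < D)%N -> B k != 0) ->
  (forall k k', (k < k' < D)%N -> (size (B k') < size (B k))%N) ->
  \sum_(k < D) a k *: B k = 0 -> forall k, (k < D)%N -> a k = 0.
Proof.
move=> B0 Bs S0; elim/ltn_ind => k IH kD.
have /(congr1 (fun f : {poly F} => f`_(size (B k)).-1)) := S0.
rewrite coef0 coef_sum (bigD1 (Ordinal kD)) //= coefZ big1 ?addr0; last first.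
  move=> k' /negP k'k; have k'D := ltn_ord k'.
  rewrite coefZ; have [kk'|kk'|kk'] := ltngtP k' k.
  - by rewrite IH ?mul0r.
  - rewrite [X in _ * X]nth_default ?mulr0 // -ltnS prednK ?size_poly_gt0 ?B0 //.
    by apply: Bs; rewrite kk'.
  - by case: k'k; apply/eqP/val_inj.
move/eqP; rewrite mulf_eq0 => /orP[/eqP //|].
by rewrite lead_coef_eq0 (negbTE (B0 _ kD)).
Qed.

(* A vanishing combination of rows is a proper fraction whose expansion has too
   many leading zeros for the degree of its denominator; then partial fractions
   separate the systems, and within one system the numerators have distinct
   degrees. *)
Lemma row_coef_independent (s : nat) (p : 'I_s -> {poly F}) (D : 'I_s -> nat)
    (m : nat) (a : 'I_s -> nat -> F) :
  (forall c, (1 < size (p c))%N) ->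
  (forall c c', c != c' -> coprimep (p c) (p c')) ->
  (\sum_c (D c + (size (p c)).-1) <= m)%N ->
  (forall l, (l < m)%N ->
     \sum_c \sum_(k < D c) a c k * row_coef (p c) k l = 0) ->
  forall c k, (k < D c)%N -> a c k = 0.
Proof.
move=> p1 pco Dm a0.
pose e c := (size (p c)).-1; pose M c := (D c %/ e c).+1.
have e0 c : (0 < e c)%N by have := p1 c; rewrite /e; lia.
have p0 c : p c != 0 by rewrite -size_poly_gt0; exact: ltn_trans (p1 c).
have kM c k : (k < D c)%N -> ((k %/ e c).+1 <= M c)%N.
  by move=> kD; rewrite ltnS leq_div2r // ltnW.
(* [g] is the common denominator. [B c k] is the numerator of row [k] over [p c ^+ M c], and [H c]
   is the cofactor that brings it over [g]. *)
pose B c k := 'X^(e c - k %% e c - 1) * p c ^+ (M c - (k %/ e c).+1).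
pose H c := \prod_(c' | c' != c) p c' ^+ M c'.
pose A c := \sum_(k < D c) a c k *: B c k.
pose g := \prod_c p c ^+ M c.
have gE c : g = p c ^+ M c * H c by rewrite /g (bigD1 c).
have pM0 c n : p c ^+ n != 0 by rewrite expf_neq0.
have g0 : g != 0 by apply/prodf_neq0.
have H0 c : H c != 0 by apply/prodf_neq0.
have sB c k : (k < D c)%N -> size (B c k) = (e c * M c - k)%N.
  move=> kD; rewrite size_mul ?pM0 -?size_poly_gt0 ?size_polyXn //.
  rewrite size_exp_neq0 ?p0 // -/(e c).
  have := kM _ _ kD; have := ltn_pmod k (e0 c); have := divn_eq k (e c).
  set z := (k %% _)%N; set i := (k %/ _)%N; move=> kE zi iM.
  rewrite mulnBr; have : (e c * i.+1 <= e c * M c)%N by rewrite leq_mul2l iM orbT.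
  by rewrite mulnSr; nia.
have B0 c k : B c k != 0 by rewrite mulf_neq0 ?pM0 // -size_poly_gt0 size_polyXn.
have sA c : (size (A c) < size (p c ^+ M c))%N.
  rewrite size_exp_neq0 ?p0 // -/(e c) ltnS (leq_trans (size_sum _ _ _)) //.
  apply/bigmax_leqP => k _; apply: leq_trans (size_scale_leq _ _) _.
  by rewrite sB // leq_subr.
(* The fraction with this numerator over [g] is proper, and its first [m] coefficients are the given
   vanishing sums. The degree of [g] is at most [m] because [e c * M c] exceeds [D c] by at most
   [e c]. *)
have AH0 : \sum_c A c * H c = 0.
  apply: (@laurent_coef_eq0 _ g m) => //.
  - rewrite ltnNge; apply/negP => /leq_trans /(_ (size_sum _ _ _)).
    apply/negP; rewrite -ltnNge.
    have [sg sgE] : exists sg, size g = sg.+1.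
      by exists (size g).-1; rewrite prednK // size_poly_gt0.
    rewrite sgE ltnS.
    apply/bigmax_leqP => c _; rewrite -ltnS -sgE (gE c).
    have [->|Ac0] := eqVneq (A c) 0; first by rewrite mul0r size_poly0 -gE size_poly_gt0.
    rewrite !size_mul //; move: (sA c) (H0 c); rewrite -size_poly_gt0.
    move: (size (A c)) (size (H c)) (size (p c ^+ M c)) => u v w; lia.
  - rewrite /g -ltnS prednK ?size_poly_gt0 // size_prod //.
    rewrite leq_subLR addnS ltnS.
    apply: (@leq_trans (\sum_c (e c * M c).+1)).
      by apply: leq_sum => c _; rewrite size_exp_neq0.
    rewrite (eq_bigr (fun c => (1 + e c * M c)%N)) // big_split /= sum1_card.
    rewrite leq_add2l; apply: leq_trans Dm; apply: leq_sum => c _.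
    by rewrite -/(e c) /M mulnSr leq_add2r mulnC leq_trunc_div.
  - move=> l lm; rewrite -[RHS](a0 l lm) laurent_coef_sum.
    apply: eq_bigr => c _; rewrite (gE c) laurent_coefMr // laurent_coef_sum.
    apply: eq_bigr => k _; rewrite laurent_coefZ; congr (_ * _).
    rewrite /B -[X in laurent_coef _ (_ ^+ X)](subnKC (kM _ _ (ltn_ord k))).
    by rewrite exprD laurent_coefMr.
(* [p c ^+ M c] divides every other summand, hence also [A c * H c]. It is coprime to [H c], and
   [A c] is too small to be a nonzero multiple. *)
have Ac0 c : A c = 0.
  have : p c ^+ M c %| A c * H c.
    have -> : A c * H c = - \sum_(c' | c' != c) A c' * H c'.
      by apply/eqP; rewrite -addr_eq0 -[X in _ == X]AH0 [X in _ == X](bigD1 c).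
    rewrite dvdpNr; apply: (big_ind (fun f => p c ^+ M c %| f)).
    - exact: dvdp0.
    - by move=> ? ?; exact: dvdp_add.
    - move=> c' c'c; rewrite dvdp_mull // /H (bigD1 c) //= 1?eq_sym //.
      exact: dvdp_mulr.
  rewrite Gauss_dvdpl; last first.
    apply: coprimep_expl; apply: (big_ind (fun f => coprimep (p c) f)).
    - exact: coprimep1.
    - by move=> f1 f2; rewrite coprimepMr => -> ->.
    - by move=> c' c'c; apply: coprimep_expr; apply: pco; rewrite eq_sym.
  by apply: contraTeq => Ac0; apply/negP => /dvdp_leq -/(_ Ac0); rewrite leqNgt sA.
move=> c; apply: (@sum_decreasing_size_eq0 _ _ (B c)) => //; last exact: Ac0.
move=> k k' /andP[kk' k'D]; rewrite !sB //; last exact: ltn_trans k'D.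
have := kM _ _ k'D; have := divn_eq k' (e c); have := ltn_pmod k' (e0 c).
by move=> *; nia.
Qed.

End niederreiter_rows.

(** * Enumerating the irreducible polynomials over F_2 *)

Section binary_expansions.

Lemma binary_digitS k l : binary_digit k l.+1 = binary_digit (k %/ 2) l.
Proof. by rewrite /binary_digit expnS divnMA. Qed.

Lemma binary_digit_lt2 k l : (binary_digit k l < 2)%N.
Proof. by rewrite ltn_mod. Qed.

Lemma binary_digit_small k l : (k < 2 ^ l)%N -> binary_digit k l = 0%N.
Proof. by move=> kl; rewrite /binary_digit divn_small. Qed.

Lemma binary_expansion n k : (k < 2 ^ n)%N ->
  k = (\sum_(l < n) binary_digit k l * 2 ^ l)%N.
Proof.
elim: n k => [|n IH] k kn; first by rewrite big_ord0; case: k kn.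
rewrite big_ord_recl /binary_digit expn0 divn1 muln1.
under eq_bigr do rewrite -/(binary_digit _ _) /= binary_digitS expnS mulnCA.
rewrite -big_distrr /= -IH; first by rewrite {1}(divn_eq k 2) addnC mulnC.
by rewrite ltn_divLR // mulnC -expnS.
Qed.

Lemma ltn_sum_bits n (b : nat -> nat) : (forall i, b i < 2)%N ->
  (\sum_(l < n) b l * 2 ^ l < 2 ^ n)%N.
Proof.
move=> b2; elim: n => [|n IH]; first by rewrite big_ord0.
rewrite big_ord_recr /= expnS mul2n -addnn -addSn leq_add //.
by rewrite -[leqRHS]mul1n leq_mul2r -ltnS b2 orbT.
Qed.

Lemma binary_digit_sum n (b : nat -> nat) j : (forall i, b i < 2)%N ->
  (j < n)%N -> binary_digit (\sum_(l < n) b l * 2 ^ l) j = b j.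
Proof.
elim: n b j => [//|n IH] b j b2 jn; rewrite big_ord_recl expn0 muln1.
under eq_bigr do rewrite /= expnS mulnCA.
rewrite -big_distrr /=; case: j jn => [|j] jn.
  by rewrite /binary_digit divn1 addnC mulnC modnMDl modn_small.
rewrite binary_digitS addnC mulnC divnMDl // divn_small // addn0.
by rewrite (IH (fun i => b i.+1)).
Qed.

End binary_expansions.

Section enumeration.

(** Each value is the least element of [P] above the previous one. An [m] in [P] equals [f j] for
    the last [j] with [f j <= m]. *)
Lemma unbounded_enumeration (P : pred nat) :
  (forall n, exists m, (n < m)%N && P m) ->
  exists2 f : nat -> nat, {homo f : i j / (i < j)%N} &
    forall m, P m <-> exists j, f j = m.
Proof.
move=> Pinf; have [m0 /andP[_ Pm0]] := Pinf 0%N.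
have exP : exists m, P m by exists m0.
pose fix f n := if n is n'.+1 then ex_minn (Pinf (f n')) else ex_minn exP.
have fS n : [/\ (f n < f n.+1)%N, P (f n.+1) &
    forall m, (f n < m)%N -> P m -> (f n.+1 <= m)%N].
  rewrite /=; case: ex_minnP => m /andP[fm Pm] mmin; split => // k fk Pk.
  by apply: mmin; rewrite fk.
have fP n : P (f n).
  by case: n => [|n]; [rewrite /=; case: ex_minnP | case: (fS n)].
have fhomo : {homo f : i j / (i < j)%N}.
  by apply: homo_ltn => [? ? ?|n]; [exact: ltn_trans | case: (fS n)].
have f_ge n : (n <= f n)%N.
  elim: n => // n IH; apply: leq_ltn_trans IH _.
  by case: (fS n).
exists f => // m; split => [Pm|[j <-]]; last exact: fP.
have f0m : (f 0 <= m)%N by rewrite /=; case: ex_minnP => k _; apply.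
have [||j fjm jmax] := @ex_maxnP (fun j => f j <= m)%N m.
- by exists 0%N.
- by move=> i; apply: leq_trans.
exists j; apply/eqP; rewrite eqn_leq fjm leqNgt; apply/negP => fj.
have [_ _ /(_ _ fj Pm)/jmax] := fS j.
by rewrite ltnn.
Qed.

(** Coefficients are read as binary digits, so the order of the codes refines the order by degree,
    and increasing codes give a list sorted by degree. *)
Definition poly_code (f : {poly 'F_2}) : nat :=
  (\sum_(i < size f) ((f`_i)%R : nat) * 2 ^ i)%N.

Lemma coef_lt2 (f : {poly 'F_2}) i : (((f`_i)%R : nat) < 2)%N.
Proof. by case: (f`_i). Qed.

Lemma poly_code_widen n (f : {poly 'F_2}) : (size f <= n)%N ->
  poly_code f = (\sum_(i < n) ((f`_i)%R : nat) * 2 ^ i)%N.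
Proof.
move=> fn; rewrite /poly_code.
rewrite (big_ord_widen n (fun i => ((f`_i)%R : nat) * 2 ^ i)%N fn).
rewrite big_mkcond; apply: eq_bigr => i _; case: ltnP => // fi.
by rewrite nth_default // mul0n.
Qed.

Lemma poly_code_inj : injective poly_code.
Proof.
move=> f g fg; apply/polyP => i; apply/val_inj => /=.
pose n := maxn i.+1 (maxn (size f) (size g)).
have iE (h : {poly 'F_2}) :
    (size h <= n)%N -> ((h`_i)%R : nat) = binary_digit (poly_code h) i.
  move=> hn; rewrite (poly_code_widen hn).
  rewrite (binary_digit_sum (b := fun i => (h`_i)%R : nat)) ?leq_max ?leqnn //.
by rewrite !iE ?fg // !leq_max leqnn !orbT.
Qed.

Lemma poly_code_ltn f : (poly_code f < 2 ^ size f)%N.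
Proof. by apply: (@ltn_sum_bits _ (fun i => (f`_i)%R : nat)) => i; exact: coef_lt2. Qed.

Lemma poly_code_geq (f : {poly 'F_2}) : f != 0 -> (2 ^ (size f).-1 <= poly_code f)%N.
Proof.
move=> f0; have sf : ((size f).-1 < size f)%N by rewrite prednK // size_poly_gt0.
rewrite /poly_code (bigD1 (Ordinal sf)) //=; apply: leq_trans (leq_addr _ _).
rewrite -[leqLHS]mul1n leq_mul2r; apply/orP; right.
by move: f0; rewrite -lead_coef_eq0 lead_coefE; case: (f`_ _) => -[|[]].
Qed.


Lemma irreducible_divisor (F : fieldType) (g : {poly F}) : (1 < size g)%N ->
  exists2 f, irreducible_poly f & f %| g.
Proof.
move: {2}(size g) (leqnn (size g)) => n; elim: n g => [|n IH] g gn g1.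
  by move: g1; rewrite ltnNge (leq_trans gn).
have [irr|] := pselect (irreducible_poly g); first by exists g.
move=> nirr; have : exists f : {poly F}, [/\ size f != 1%N, f %| g & ~~ (f %= g)].
  apply: contra_notP nirr => nex; split => // f f1 fg.
  by apply: contra_notT nex => nfg; exists f.
move=> [f [f1 fg nfg]].
have g0 : g != 0 by rewrite -size_poly_gt0 ltnW.
have f0 : f != 0 by apply: contraNneq g0 => f0; move: fg; rewrite f0 dvd0p.
have fltg : (size f < size g)%N.
  by rewrite ltn_neqAle dvdp_leq // andbT (dvdp_size_eqp fg).
have [||h hirr hf] := IH f.
- by rewrite -ltnS (leq_trans fltg).
- by move: f0 f1; rewrite -size_poly_gt0; case: (size f) => [|[]].
- by exists h => //; exact: dvdp_trans fg.
Qed.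

(** Euclid's argument: [P] is the product of all nonzero polynomials of size at most [n], and an
    irreducible factor of ['X * P + 1] divides neither ['X] nor any of these. *)
Lemma unbounded_irreducible (F : finFieldType) (n : nat) :
  exists f : {poly F}, [/\ irreducible_poly f, f <> 'X & (n < size f)%N].
Proof.
pose P := \prod_(v : 'rV[F]_n | v != 0) rVpoly v.
have P0 : P != 0.
  apply/prodf_neq0 => v; apply: contra_neq => v0.
  by rewrite -[v]rVpolyK v0 linear0.
have XPE : size ('X * P) = (size P).+1 by rewrite mulrC size_mulX.
have g1 : (1 < size ('X * P + 1)%R)%N.
  by rewrite size_polyDl XPE ?size_poly1 ?ltnS size_poly_gt0.
have [f firr fg] := irreducible_divisor g1.
have f1 : ~~ (f %| 1).
  by rewrite dvdp1; case: firr => + _; case: (size f) => [|[]].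
exists f; split => //.
  move=> fX; move: fg f1; rewrite fX dvdp_addr ?dvdp_mulIl // => ->//.
rewrite ltnNge; apply/negP => fn.
move: fg f1; rewrite dvdp_addr => [->//|].
rewrite dvdp_mull // /P (bigD1 (poly_rV f)) /=; last first.
  apply: contra_neq (irredp_neq0 firr) => f0.
  by rewrite -(poly_rV_K fn) f0 linear0.
by rewrite poly_rV_K // dvdp_mulIl.
Qed.

Lemma irreducible_enumeration_exists :
  exists q : nat -> {poly 'F_2}, irreducible_enumeration q.
Proof.
pose Q m (f : {poly 'F_2}) := [/\ irreducible_poly f, f <> 'X & poly_code f = m].
have [|f fhomo fP] := @unbounded_enumeration (fun m => `[< exists f, Q m f >]).
  move=> n; have [f [firr fX nf]] := unbounded_irreducible 'F_2 n.+1.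
  exists (poly_code f); apply/andP; split; last by apply/asboolP; exists f.
  apply: leq_trans (poly_code_geq (irredp_neq0 firr)).
  apply: (@leq_trans (size f).-1.+1); last exact: ltn_expl.
  by move: nf; case: (size f) => // s; exact: ltnW.
have /choice[q qP] : forall j, exists g, Q (f j) g.
  by move=> j; apply/asboolP/fP; exists j.
have finj : injective f.
  by move=> i j fij; have [/fhomo|/fhomo|] := ltngtP i j; rewrite ?fij ?ltnn.
exists q; split.
- move=> i j qij; apply: finj.
  by have [_ _ <-] := qP i; have [_ _ <-] := qP j; rewrite qij.
- move=> g; split => [[girr gX]|[j <-]]; last by have [] := qP j.
  have /fP[j fj] : `[< exists f, Q (poly_code g) f >] by apply/asboolP; exists g.
  exists j; have [_ _ qE] := qP j; apply: poly_code_inj.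
  by rewrite qE fj.
- move=> i j; rewrite leq_eqVlt => /orP[/eqP->//|/fhomo fij].
  rewrite leqNgt; apply/negP => ji.
  have [qirr _ qi] := qP i; have [_ _ qj] := qP j.
  have := poly_code_ltn (q j); rewrite qj.
  have := poly_code_geq (irredp_neq0 qirr); rewrite qi => fi fj.
  suff : (f i < f j)%N = false by rewrite fij.
  apply/negbTE; rewrite -leqNgt; apply: leq_trans fi; apply: ltnW.
  apply: leq_trans fj _; rewrite leq_exp2l //.
  by move: ji; case: (size (q i)).
Qed.

(** Pigeonhole: one of [q0 0], ..., [q0 j] occurs in [q] at a position at least [j]. Hence degree
    sums computed from one enumeration bound those of every other one. *)
Lemma irreducible_enumeration_size q q0 j :
  irreducible_enumeration q -> irreducible_enumeration q0 ->
  (size (q j) <= size (q0 j))%N.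
Proof.
move=> [qinj qP qs] [q0inj q0P q0s].
have /choice[s sE] : forall i, exists k, q k = q0 i.
  by move=> i; apply/qP/q0P; exists i.
have sinj : injective s by move=> i k sik; apply: q0inj; rewrite -!sE sik.
have [[i [ij js]]|nex] := pselect (exists i, (i <= j)%N /\ (j <= s i)%N).
  by apply: leq_trans (qs _ _ js) _; rewrite sE q0s.
have sj (i : 'I_j.+1) : (s i < j)%N.
  rewrite ltnNge; apply/negP => js; apply: nex; exists i.
  by rewrite -ltnS ltn_ord.
have : (#|'I_j.+1| <= #|'I_j|)%N.
  apply: (@leq_card _ _ (fun i => Ordinal (sj i))) => i k [/sinj ik].
  exact: val_inj.
by rewrite !card_ord ltnn.
Qed.

Lemma base_poly_irreducible q c : irreducible_enumeration q ->
  irreducible_poly (base_poly q c).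
Proof.
case: c => [|c] [_ qP _] /=; last by have [] := (qP (q c)).2 (ex_intro _ c erefl).
by rewrite -[X in irreducible_poly X]subr0 -[X in _ - X]polyC0; exact: irredp_XsubC.
Qed.

Lemma base_poly_inj q : irreducible_enumeration q -> injective (base_poly q).
Proof.
move=> [qinj qP _] [|i] [|j] //=; last by move/qinj ->.
- by move=> qj; have [_ /(_ (esym qj))] := (qP (q j)).2 (ex_intro _ j erefl).
- by move=> qi; have [_ /(_ qi)] := (qP (q i)).2 (ex_intro _ i erefl).
Qed.

(** Nonzero polynomials over F_2 are monic, so associated irreducibles are equal. *)
Lemma coprimep_irreducible_F2 (f g : {poly 'F_2}) :
  irreducible_poly f -> irreducible_poly g -> f <> g -> coprimep f g.
Proof.
move=> firr girr fg; rewrite coprimep_def; apply/negPn/negP => h1; apply: fg.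
have hf := firr.2 _ h1 (dvdp_gcdl f g).
have hg := girr.2 _ h1 (dvdp_gcdr f g).
have F2monic (h : {poly 'F_2}) : irreducible_poly h -> h \is monic.
  move=> /irredp_neq0; rewrite -lead_coef_eq0 monicE.
  by case: (lead_coef h) => -[|[]].
apply/eqP; rewrite -(eqp_monic (F2monic _ firr) (F2monic _ girr)).
by apply: eqp_trans hg; rewrite eqp_sym.
Qed.

End enumeration.

(** * Equidistribution of digits in aligned blocks *)

Section interlaced_rows.

Lemma sum_parity (V : nmodType) (n : nat) (f : nat -> V) :
  \sum_(c < 2 * n) f c = \sum_(i < n) (f (2 * i)%N + f (2 * i + 1)%N).
Proof.
elim: n => [|n IH]; first by rewrite muln0 !big_ord0.
by rewrite mulnS !big_ord_recr /= IH addn1 addrA.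
Qed.

Lemma sum_widen0 (V : nmodType) (n m : nat) (f : nat -> V) : (n <= m)%N ->
  (forall l, (n <= l)%N -> f l = 0) -> \sum_(l < n) f l = \sum_(l < m) f l.
Proof.
move=> nm f0; rewrite (big_ord_widen m f nm) big_mkcond.
by apply: eq_bigr => l _; case: ltnP => // /f0 ->.
Qed.

Variables (q : nat -> {poly 'F_2}) (d t : nat).
Hypothesis q_enum : irreducible_enumeration q.
Hypothesis t_ge : (\sum_(c < 2 * d) (size (base_poly q c)).-1 <= t)%N.

(** Row 2 k + v of the interlaced matrix i is row k of the Niederreiter matrix 2 i + v. The rows
    allowed by [lam] thus lie in initial segments of two matrices, whose lengths add up to at most
    (2 j i + m i + 3) / 2, and [row_coef_independent] applies. *)
Lemma interlace_independent (j m : nat -> nat) (mu P : nat)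
    (lam : nat -> nat -> 'F_2) :
  (2 * (t + 2 * d) + \sum_(i < d) (2 * j i + m i) <= 2 * mu)%N ->
  (forall i p, (i < d)%N -> lam i p != 0 -> (p < j i)%N || (p == j i + m i)%N) ->
  (forall i, (i < d)%N -> (j i + m i < 2 * P)%N) ->
  (forall l, (l < mu)%N ->
    \sum_(i < d) \sum_(p < 2 * P)
      lam i p * interlace (niederreiter q) i p l = 0) ->
  forall i p, (i < d)%N -> lam i p = 0.
Proof.
move=> jm_mu lam_supp jmP lam0.
(* Only the matrix whose parity matches [j i + m i] has to reach that far row; the other one needs
   just the rows below [j i]. *)
pose D (c : nat) := let i := (c %/ 2)%N in
  if (c %% 2 == (j i + m i) %% 2)%N then ((j i + m i) %/ 2).+1 else ((j i).+1 %/ 2)%N.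
pose a (c k : nat) := lam (c %/ 2)%N (2 * k + c %% 2)%N.
have pE i k v : (i < d)%N -> (v < 2)%N -> lam i (2 * k + v)%N != 0 ->
    (k < D (2 * i + v)%N)%N.
  move=> id v2 /(lam_supp _ _ id); rewrite /D.
  have -> : ((2 * i + v) %/ 2 = i)%N by lia.
  have -> : ((2 * i + v) %% 2 = v)%N by lia.
  by case: ifP => /eqP; lia.
have DP i v : (i < d)%N -> (v < 2)%N -> (D (2 * i + v)%N <= P)%N.
  move=> id v2; rewrite /D.
  have -> : ((2 * i + v) %/ 2 = i)%N by lia.
  have -> : ((2 * i + v) %% 2 = v)%N by lia.
  by have := jmP _ id; case: ifP => /eqP; lia.
have indep := @row_coef_independent _ (2 * d) (fun c => base_poly q c)
  (fun c => D c) mu (fun c => a c).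
move=> i p id; apply/eqP/negPn/negP => lamip.
have pv : p = (2 * (p %/ 2) + p %% 2)%N by lia.
have c2d : (2 * i + p %% 2 < 2 * d)%N by lia.
have : a (2 * i + p %% 2)%N (p %/ 2)%N = 0.
  apply: (indep _ _ _ _ (Ordinal c2d)).
  - by move=> c; case: (base_poly_irreducible c q_enum).
  - move=> c c' cc'; apply: coprimep_irreducible_F2; try exact: base_poly_irreducible.
    by move=> /(base_poly_inj q_enum) /val_inj; apply/eqP.
  - rewrite big_split /=; apply: leq_trans (leq_add (leqnn _) t_ge) _.
    rewrite (sum_parity d D : _ = \sum_(i < d) (D (2 * i) + D (2 * i + 1)))%N.
    suff : (2 * \sum_(i0 < d) (D (2 * i0) + D (2 * i0 + 1)) <=
            \sum_(i0 < d) (2 * j i0 + m i0 + 3))%N.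
      have -> : (\sum_(i0 < d) (2 * j i0 + m i0 + 3) =
                 \sum_(i0 < d) (2 * j i0 + m i0) + d * 3)%N.
        by rewrite big_split /= sum_nat_const card_ord.
      lia.
    rewrite big_distrr; apply: leq_sum => c _; rewrite /D.
    have -> : ((2 * c) %/ 2 = c)%N by lia.
    have -> : ((2 * c) %% 2 = 0)%N by lia.
    have -> : ((2 * c + 1) %/ 2 = c)%N by lia.
    have -> : ((2 * c + 1) %% 2 = 1)%N by lia.
    by rewrite /=; case: eqP => ?; case: eqP => ?; lia.
  - move=> l lmu; rewrite -[RHS](lam0 l lmu).
    rewrite (sum_parity d (fun c => \sum_(k < D c) a c k * row_coef (base_poly q c) k l)).
    apply: eq_bigr => c _.
    rewrite (sum_parity P (fun p => lam c p * interlace (niederreiter q) c p l)).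
    rewrite big_split; congr (_ + _).
      rewrite (@sum_widen0 _ _ P
        (fun k => a (2 * c)%N k * row_coef (base_poly q (2 * c)) k l)).
      + apply: eq_bigr => k _; rewrite /a /interlace -/(niederreiter q _ _ _).
        have -> : ((2 * c) %/ 2 = c)%N by lia.
        have -> : ((2 * c) %% 2 = 0)%N by lia.
        have -> : ((2 * k) %/ 2 = k)%N by lia.
        have -> : ((2 * k) %% 2 = 0)%N by lia.
        by rewrite !addn0.
      + by have := @DP c 0%N (ltn_ord c) erefl; rewrite addn0.
      + move=> k; have := @pE c k 0%N (ltn_ord c) erefl; rewrite !addn0 ltnNge /a.
        have -> : ((2 * c) %/ 2 = c)%N by lia.
        have -> : ((2 * c) %% 2 = 0)%N by lia.
        rewrite addn0 => nk Dk; have [->|/nk] := eqVneq (lam c (2 * k)%N) 0.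
          by rewrite mul0r.
        by rewrite Dk.
    rewrite (@sum_widen0 _ _ P
      (fun k => a (2 * c + 1)%N k * row_coef (base_poly q (2 * c + 1)) k l)).
    + apply: eq_bigr => k _; rewrite /a /interlace -/(niederreiter q _ _ _).
      have -> : ((2 * c + 1) %/ 2 = c)%N by lia.
      have -> : ((2 * c + 1) %% 2 = 1)%N by lia.
      have -> : ((2 * k + 1) %/ 2 = k)%N by lia.
      by have -> : ((2 * k + 1) %% 2 = 1)%N by lia.
    + exact: @DP c 1%N (ltn_ord c) erefl.
    + move=> k; have := @pE c k 1%N (ltn_ord c) erefl; rewrite ltnNge /a.
      have -> : ((2 * c + 1) %/ 2 = c)%N by lia.
      have -> : ((2 * c + 1) %% 2 = 1)%N by lia.
      move=> nk Dk; have [->|/nk] := eqVneq (lam c (2 * k + 1)%N) 0.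
        by rewrite mul0r.
      by rewrite Dk.
  - by apply: pE; rewrite ?ltn_mod // -pv.
rewrite /a.
have -> : ((2 * i + p %% 2) %/ 2 = i)%N by lia.
have -> : ((2 * i + p %% 2) %% 2 = p %% 2)%N by lia.
by rewrite -pv => lam_eq0; rewrite lam_eq0 eqxx in lamip.
Qed.

End interlaced_rows.

(** * Counting the points of a block under independent digit conditions *)

Section digital_blocks.

(** The digits identify ['I_(2 ^ mu)] with F_2^mu. Independent rows give a surjective linear map,
    all of whose fibers have the same size. *)
Lemma card_affine_fiber (mu : nat) (T : finType) (U : T -> nat -> 'F_2)
    (c : T -> 'F_2) :
  (forall x : T -> 'F_2,
    (forall l, (l < mu)%N -> \sum_s x s * U s l = 0) -> forall s, x s = 0) ->
  (#|[pred k : 'I_(2 ^ mu) |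
      [forall s, (\sum_(l < mu) U s l * (binary_digit k l)%:R == c s)%R]]|
   * 2 ^ #|T| = 2 ^ mu)%N.
Proof.
move=> Uind.
pose f (k : 'I_(2 ^ mu)) : 'cV['F_2]_mu := \col_l (binary_digit k l)%:R.
have finj : injective f.
  move=> k k' fk; apply: val_inj => /=.
  rewrite (binary_expansion (ltn_ord k)) (binary_expansion (ltn_ord k')).
  apply: eq_bigr => l _; have := congr1 (fun v : 'cV_mu => v l 0) fk; rewrite !mxE.
  have := binary_digit_lt2 k l; have := binary_digit_lt2 k' l.
  by case: (binary_digit k l) => [|[|?]] //; case: (binary_digit k' l) => [|[|?]].
have cardcV n : #|'cV['F_2]_n| = (2 ^ n)%N by rewrite card_mx muln1 card_Fp.
have fbij : bijective f by apply: inj_card_bij => //; rewrite cardcV card_ord.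
pose A : 'M['F_2]_(#|T|, mu) := \matrix_(s, l) U (enum_val s) l.
have Afree : row_free A.
  apply: inj_row_free => v vA0; apply/rowP => s; rewrite mxE.
  rewrite -(enum_valK s); apply: (Uind (fun s => v 0 (enum_rank s))) => l lmu.
  have := congr1 (fun w : 'rV_mu => w 0 (Ordinal lmu)) vA0; rewrite !mxE => {2}<-.
  rewrite (reindex (@enum_val T predT)) /=; last exact: onW_bij (enum_val_bij T).
  by apply: eq_bigr => s' _; rewrite mxE enum_valK.
(* [A] is row free, so [pinvmx A] is a right inverse and translation by [pinvmx A *m w] carries the
   kernel onto the fiber over [w]. *)
have fiber_shift (w : 'cV_#|T|) :
    (\sum_(v : 'cV_mu | (A *m v == w)%R) 1 = \sum_(v : 'cV_mu | (A *m v == 0)%R) 1)%N.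
  pose h (v : 'cV_mu) := v + pinvmx A *m w.
  have hbij : bijective h.
    by exists (fun v => v - pinvmx A *m w) => v; rewrite /h ?addrK ?subrK.
  rewrite (reindex h) /=; last exact: onW_bij.
  apply: eq_bigl => v.
  by rewrite mulmxDr mulmxA mulmxVp // mul1mx -subr_eq0 addrK.
pose w : 'cV['F_2]_#|T| := \col_s c (enum_val s).
have -> : #|[pred k : 'I_(2 ^ mu) |
      [forall s, \sum_(l < mu) U s l * (binary_digit k l)%:R == c s]]| =
    (\sum_(v : 'cV_mu | (A *m v == w)%R) 1)%N.
  rewrite -sum1_card (reindex f) /=; last exact: onW_bij.
  apply: eq_bigl => k; rewrite inE; apply/forallP/eqP => [kc|kw s].
    apply/colP => s; rewrite !mxE -(eqP (kc (enum_val s))).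
    by apply: eq_bigr => l _; rewrite !mxE.
  have := congr1 (fun v : 'cV_#|T| => v (enum_rank s) 0) kw.
  rewrite !mxE enum_rankK => <-.
  by apply/eqP/eq_bigr => l _; rewrite !mxE enum_rankK.
rewrite -[RHS]cardcV -[RHS]sum1_card.
rewrite [RHS](partition_big (fun v : 'cV_mu => A *m v) predT) //=.
rewrite [RHS](eq_bigr (fun=> (\sum_(v : 'cV_mu | (A *m v == w)%R) 1)%N)); last first.
  by move=> w' _; rewrite fiber_shift -(fiber_shift w').
by rewrite [RHS]sum_nat_const cardcV mulnC.
Qed.

End digital_blocks.

Section bits.

Definition agree (J : nat) (a y : nat -> bool) : bool :=
  [forall l : 'I_J, a l == y l].

(* The convention prev_bit 0 y = true makes tent L 0 y equal to 1 - y, the mean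
   over a of the indicator of y <= a. *)
Definition prev_bit (j : nat) (y : nat -> bool) : bool :=
  if j is j'.+1 then y j' else true.

Definition bit_change (j m : nat) (y : nat -> bool) : bool :=
  prev_bit j y (+) y (j + m)%N.

Definition point_bit (E : nat -> nat -> nat -> 'F_2) (k i p : nat) : bool :=
  digit_vector (E i) k p != 0.

End bits.

Section digital_blocks_of_points.

Lemma digit_vector_widen (E : nat -> nat -> 'F_2) (k M p : nat) :
  (k < 2 ^ M)%N ->
  digit_vector E k p = \sum_(l < M) E p l * (binary_digit k l)%:R.
Proof.
move=> kM; rewrite /digit_vector.
have zero n l : (k < 2 ^ n)%N -> (n <= l)%N -> E p l * (binary_digit k l)%:R = 0.
  move=> kn nl; rewrite binary_digit_small ?mulr0 //.
  by apply: leq_trans kn _; rewrite leq_exp2l.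
pose f l := E p l * (binary_digit k l)%:R.
rewrite (@sum_widen0 _ k (maxn k M) f) ?leq_maxl //; last first.
  by move=> l; apply: zero; exact: ltn_expl.
by rewrite -(@sum_widen0 _ M (maxn k M) f) ?leq_maxr // => l; exact: zero.
Qed.

(** The low [mu] binary digits of the index come from [k] and the others from [b]. Within an aligned
    block the digits of the points are therefore affine functions of the digits of [k]. *)
Lemma digit_vector_block (E : nat -> nat -> 'F_2) (mu b k p : nat) :
  (k < 2 ^ mu)%N ->
  digit_vector E (b * 2 ^ mu + k) p =
  \sum_(l < mu) E p l * (binary_digit k l)%:R + digit_vector E (b * 2 ^ mu) p.
Proof.
move=> kmu.
have ltM k' : (k' < 2 ^ mu)%N -> (b * 2 ^ mu + k' < 2 ^ (mu + b))%N.
  move=> k'mu; rewrite expnD [ltnRHS]mulnC; apply: (@leq_trans (b.+1 * 2 ^ mu)).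
    by rewrite mulSn addnC ltn_add2r.
  by rewrite leq_mul2r; apply/orP; right; exact: ltn_expl.
have mu0 : (0 < 2 ^ mu)%N by rewrite expn_gt0.
have low k' l : (l < mu)%N -> binary_digit (b * 2 ^ mu + k') l = binary_digit k' l.
  move=> lmu; rewrite /binary_digit.
  have -> : (b * 2 ^ mu = b * 2 ^ (mu - l.+1) * 2 * 2 ^ l)%N.
    by rewrite -!mulnA -expnS -expnD subnK.
  by rewrite divnMDl ?expn_gt0 // modnMDl.
have high k' l : (k' < 2 ^ mu)%N ->
    binary_digit (b * 2 ^ mu + k') (mu + l) = binary_digit b l.
  by move=> k'mu; rewrite /binary_digit expnD divnMA divnMDl // (divn_small k'mu) addn0.
rewrite (digit_vector_widen _ _ (ltM _ kmu)).
have /digit_vector_widen -> : (b * 2 ^ mu < 2 ^ (mu + b))%N.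
  by rewrite -[ltnLHS]addn0; exact: ltM.
rewrite !big_split_ord /= addrA; congr (_ + _).
  rewrite -[LHS]addr0; congr (_ + _).
    by apply: eq_bigr => l _; rewrite low.
  apply/esym/big1 => l _; rewrite -[X in binary_digit X]addn0 low //.
  by rewrite /binary_digit div0n mulr0.
by apply: eq_bigr => l _; rewrite -[in RHS](addn0 (b * 2 ^ mu)%N) !high.
Qed.

Lemma sum_pick (R : pzSemiRingType) (n c : nat) (f : nat -> R) : (c < n)%N ->
  \sum_(p < n) (val p == c)%:R * f p = f c.
Proof.
move=> cn; rewrite (bigD1 (Ordinal cn)) //= eqxx mul1r big1 ?addr0 // => p pc.
by rewrite -[val p == c]/(p == Ordinal cn) (negbTE pc) mul0r.
Qed.

Variable q : nat -> {poly 'F_2}.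
Hypothesis q_enum : irreducible_enumeration q.
Let E := interlace (niederreiter q).

Lemma niederreiter_eq0 c k l : (l < k)%N -> niederreiter q c k l = 0.
Proof.
by apply: row_coef_eq0; case: (base_poly_irreducible c q_enum).
Qed.

(** Row [p] comes from row p / 2 >= n of an upper triangular matrix, and [k] has only [n] digits.
    This is the reason for grids with 2 n digits. *)
Lemma point_bit_eq0 n k i p : (k < 2 ^ n)%N -> (2 * n <= p)%N ->
  point_bit E k i p = false.
Proof.
move=> kn np; rewrite /point_bit (digit_vector_widen _ _ kn) big1 ?eqxx //.
move=> l _; rewrite /E /interlace niederreiter_eq0 ?mul0r //.
by have := ltn_ord l; lia.
Qed.

Variables d t : nat.
Hypothesis t_ge : (\sum_(c < 2 * d) (size (base_poly q c)).-1 <= t)%N.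

(** All conditions are affine equations in the digits of [k], independent by
    [interlace_independent]. The flag [z] switches the digit-change condition on, so that plain
    boxes are covered too. *)
Lemma block_count (z : bool) (mu b : nat) (j m : nat -> nat)
    (a : nat -> nat -> bool) :
  (2 * (t + 2 * d) + \sum_(i < d) (2 * j i + m i) <= 2 * mu)%N ->
  (#|[pred k : 'I_(2 ^ mu) | [forall i : 'I_d,
       agree (j i).-1 (a i) (point_bit E (b * 2 ^ mu + k) i) &&
       (z ==> bit_change (j i) (m i) (point_bit E (b * 2 ^ mu + k) i))]]|
   * 2 ^ (\sum_(i < d) ((j i).-1 + z)) = 2 ^ mu)%N.
Proof.
(* [T] indexes the equations: an index below [(j i).-1] fixes that digit, and the index [(j i).-1],
   present when [z] holds, is the digit change. *)
move=> jm_mu; pose T := {i : 'I_d & 'I_((j i).-1 + z)}.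
pose P := (\sum_(i < d) (j i + m i)).+1.
have jmP (i : 'I_d) : (j i + m i < 2 * P)%N.
  rewrite mul2n -addnn; apply: leq_trans (leq_addr _ _).
  by rewrite ltnS (bigD1 i) //= leq_addr.
(* Coefficients of the equations in terms of the digits. For [j i = 0] there is no previous digit;
   the value true of [prev_bit] then turns the right-hand side in [c] into 0. The rest of [c]
   accounts for the first point of the block. *)
pose delta (i p' p : nat) : 'F_2 := if (p' < (j i).-1)%N then (p == p')%:R
  else ((0 < j i)%N && (p == (j i).-1))%:R + (p == j i + m i)%:R.
pose U (s : T) (l : nat) : 'F_2 :=
  \sum_(p < 2 * P) delta (tag s) (tagged s) p * E (tag s) p l.
pose c (s : T) : 'F_2 :=
  (if (tagged s < (j (tag s)).-1)%N then (a (tag s) (tagged s))%:R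
   else (0 < j (tag s))%N%:R)
  - \sum_(p < 2 * P) delta (tag s) (tagged s) p * digit_vector (E (tag s)) (b * 2 ^ mu) p.
have cardT : #|{: T}| = (\sum_(i < d) ((j i).-1 + z))%N.
  rewrite card_tagged sumnE big_map big_enum /=.
  by apply: eq_bigr => i _; rewrite card_ord.
rewrite -cardT -[RHS](@card_affine_fiber mu T U c); last first.
  move=> x xU0 [i p'].
  (* A relation among the equations becomes a relation [lam] among rows. Its value at [p'] isolates
     an agreement equation, and its value at [j i + m i], a digit in no agreement equation, isolates
     the change. *)
  pose lam (i p : nat) := if (insub i : option 'I_d) is Some i'
    then \sum_(p' < (j i').-1 + z) x (Tagged _ p') * delta i' p' p else 0.
  have lamE (i0 : 'I_d) p : lam i0 p =
      \sum_(p' < (j i0).-1 + z) x (Tagged _ p') * delta i0 p' p.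
    by rewrite /lam valK.
  have lam0 p : lam i p = 0.
    apply: (@interlace_independent q d t q_enum t_ge j m mu P) => //.
    - move=> i0 p0 i0d; rewrite (lamE (Ordinal i0d)); apply: contraNT.
      rewrite negb_or => /andP[p0j p0jm]; apply/eqP/big1 => p1 _ /=.
      rewrite /delta; have [p1j|jp1] := ltnP.
        rewrite (_ : (_ == _) = false) ?mulr0 //; apply/negbTE.
        by apply: contraNneq p0j => ->; lia.
      rewrite (negbTE p0jm) (_ : _ && _ = false) ?addr0 ?mulr0 //.
      by apply/negbTE; apply: contra p0j; lia.
    - by move=> i0 i0d; exact: (jmP (Ordinal i0d)).
    - move=> l lmu; rewrite -[RHS](xU0 l lmu).
      pose G (i : 'I_d) (p' : 'I_((j i).-1 + z)) : 'F_2 :=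
        x (Tagged _ p') * U (Tagged _ p') l.
      transitivity (\sum_i \sum_p' G i p'); last first.
        by rewrite (sig_big_dep predT (fun i => predT) G); apply: eq_bigr => -[].
      apply: eq_bigr => i0 _.
      under eq_bigr do rewrite lamE big_distrl /=.
      rewrite exchange_big /=; apply: eq_bigr => p1 _.
      by rewrite /G /U big_distrr /=; apply: eq_bigr => p2 _; rewrite mulrA.
  have [p'j|jp'] := ltnP p' (j i).-1.
    rewrite -[RHS](lam0 p') lamE (bigD1 p') //= big1 => [|p1 p1p'].
      by rewrite addr0 /delta p'j eqxx mulr1.
    rewrite /delta; have [p1j|jp1] := ltnP.
      by rewrite eq_sym [_ == _](negbTE p1p') mulr0.
    have p'jm : (p' < j i + m i)%N.
      by apply: leq_trans p'j _; exact: leq_trans (leq_pred _) (leq_addr _ _).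
    by rewrite (ltn_eqF p'j) andbF (ltn_eqF p'jm) addr0 mulr0.
  rewrite -[RHS](lam0 (j i + m i)%N) lamE (bigD1 p') //= big1 => [|p1 p1p'].
    rewrite addr0 /delta ltnNge jp' /= eqxx.
    have -> : (0 < j i)%N && (j i + m i == (j i).-1)%N = false.
      by case: (j i) => //= n; rewrite gtn_eqF // ltnS leq_addr.
    by rewrite add0r mulr1.
  have p1j : (p1 < (j i).-1)%N.
    have le_pred (p2 : 'I_((j i).-1 + z)) : (p2 <= (j i).-1)%N.
      rewrite -ltnS; apply: leq_trans (ltn_ord p2) _.
      by rewrite -addn1 leq_add2l leq_b1.
    have p'E : p' = (j i).-1 :> nat by apply/eqP; rewrite eqn_leq jp' le_pred.
    rewrite ltn_neqAle le_pred andbT; apply: contra_neq p1p' => p1E.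
    exact: val_inj (etrans p1E (esym p'E)).
  have p1jm : (p1 < j i + m i)%N.
    by apply: leq_trans p1j _; exact: leq_trans (leq_pred _) (leq_addr _ _).
  by rewrite /delta p1j (gtn_eqF p1jm) mulr0.
congr (_ * _)%N; apply: eq_card => k; rewrite !inE.
have F2E (u v : 'F_2) : (u == v) = ((u != 0) == (v != 0)).
  by case: u => -[|[|?]] ?; case: v => -[|[|?]] ?.
have F2n (x : bool) : (x%:R != 0 :> 'F_2) = x by case: x.
have F2D (u v : 'F_2) : (u + v != 0) = ((u != 0) (+) (v != 0)).
  by case: u => -[|[|?]] ?; case: v => -[|[|?]] ?.
have eventE (s : T) :
    (\sum_(l < mu) U s l * (binary_digit k l)%:R == c s) =
    (if (tagged s < (j (tag s)).-1)%N
     then a (tag s) (tagged s) == point_bit E (b * 2 ^ mu + k) (tag s) (tagged s)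
     else bit_change (j (tag s)) (m (tag s)) (point_bit E (b * 2 ^ mu + k) (tag s))).
  case: s => i p' /=; rewrite /c /= [LHS]eq_sym subr_eq eq_sym.
  have -> : \sum_(l < mu) U (Tagged _ p') l * (binary_digit k l)%:R +
      \sum_(p < 2 * P) delta i p' p * digit_vector (E i) (b * 2 ^ mu) p =
      \sum_(p < 2 * P) delta i p' p * digit_vector (E i) (b * 2 ^ mu + k) p.
    under [in RHS]eq_bigr do rewrite digit_vector_block // mulrDr.
    rewrite big_split; congr (_ + _); rewrite /U /=.
    under eq_bigr do rewrite big_distrl /=.
    rewrite exchange_big; apply: eq_bigr => p _; rewrite big_distrr /=.
    by apply: eq_bigr => l _; rewrite mulrA.
  have jmPi := jmP i.
  rewrite /delta; case: ifPn => p'j.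
    rewrite sum_pick; last by lia.
    by rewrite F2E F2n eq_sym.
  under eq_bigr do rewrite mulrDl; rewrite big_split /= sum_pick //.
  rewrite /bit_change F2E F2n F2D -/(point_bit _ _ _ _).
  case: (j i) jmPi => [|j'] jmPi /=.
    rewrite big1 => [|p _]; last by rewrite mul0r.
    by rewrite eqxx /=; case: (point_bit _ _ _ _).
  rewrite sum_pick ?eqb_id //; lia.
apply/forallP/forallP => [H [i p']|H i].
  rewrite eventE /=; have /andP[/forallP Ha Hz] := H i.
  case: ifPn => p'j; first exact: Ha (Ordinal p'j).
  apply: (implyP Hz); have := leq_ltn_trans _ (ltn_ord p'); move: p'j.
  rewrite -leqNgt => jp' /(_ _ jp'); rewrite -{1}[(j i).-1]addn0 ltn_add2l.
  by rewrite lt0b.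
apply/andP; split.
  apply/forallP => l; have lz : (l < (j i).-1 + z)%N.
    by apply: leq_trans (leq_addr _ _).
  by have := H (Tagged _ (Ordinal lz)); rewrite eventE /= ltn_ord.
apply/implyP => z1; have lz : ((j i).-1 < (j i).-1 + z)%N by rewrite z1 addn1.
by have := H (Tagged _ (Ordinal lz)); rewrite eventE /= ltnn.
Qed.

End digital_blocks_of_points.

(** * Sums of tent functions over a dyadic box *)

Section local_discrepancy.
Variable R : realFieldType.

(* The last weight is doubled so that the sum is 1; it stands for all the digits
   from position L on, which vanish. *)
Definition dyadic_weight (n m : nat) : R :=
  if (m < n)%N then 2^-1 ^+ m.+1 else if m == n then 2^-1 ^+ n else 0.

Lemma dyadic_weight_ge0 n m : 0 <= dyadic_weight n m.
Proof. by rewrite /dyadic_weight; do 2?case: ifP => // _; rewrite exprn_ge0. Qed.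

Lemma sum_dyadic_weight (L n : nat) (f : nat -> R) : (n <= L)%N ->
  \sum_(m < L.+1) dyadic_weight n m * f m =
  \sum_(m < n) 2^-1 ^+ m.+1 * f m + 2^-1 ^+ n * f n.
Proof.
move=> nL; rewrite -(@sum_widen0 _ n.+1 L.+1 (fun m => dyadic_weight n m * f m)) //.
  rewrite big_ord_recr /= {2}/dyadic_weight ltnn eqxx; congr (_ + _).
  by apply: eq_bigr => m _; rewrite /dyadic_weight ltn_ord.
by move=> m nm; rewrite /dyadic_weight ltnNge ltnW //= gtn_eqF // mul0r.
Qed.

Lemma sum_half_powers n : \sum_(m < n) 2^-1 ^+ m.+1 = 1 - 2^-1 ^+ n :> R.
Proof.
elim: n => [|n IH]; first by rewrite big_ord0 expr0 subrr.
by rewrite big_ord_recr /= IH exprS; field.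
Qed.

Lemma sum_dyadic_weight1 (L n : nat) : (n <= L)%N ->
  \sum_(m < L.+1) dyadic_weight n m = 1.
Proof.
move=> nL; transitivity (\sum_(m < L.+1) dyadic_weight n m * 1).
  by apply: eq_bigr => m _; rewrite mulr1.
rewrite (sum_dyadic_weight (fun=> 1)) //; under eq_bigr do rewrite mulr1.
by rewrite sum_half_powers mulr1 subrK.
Qed.

(** The base 3 / 2 is below 2, which keeps the sum bounded, and its square 9 / 4 exceeds 2, which
    later makes the block errors decay like (8 / 9)^(mu - r). *)
Lemma sum_dyadic_weight_exp (L n : nat) : (n <= L)%N ->
  \sum_(m < L.+1) dyadic_weight n m * (3 / 2) ^+ m <= 4.
Proof.
move=> nL; rewrite (sum_dyadic_weight (fun m => (3 / 2) ^+ m)) //.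
rewrite -exprMn; under eq_bigr do rewrite exprS -mulrA -exprMn.
rewrite -big_distrr /=; set x : R := 2^-1 * (3 / 2).
have -> : \sum_(m < n) x ^+ m = 4 - 4 * x ^+ n.
  elim: n {nL} => [|n IH]; first by rewrite big_ord0 expr0; lra.
  by rewrite big_ord_recr /= IH exprS /x; field.
have : 0 <= x ^+ n by rewrite exprn_ge0 // /x; lra.
lra.
Qed.

(** A weighted mean of digit changes, so that [block_count] applies to every term; [tentE] recovers
    the piecewise linear form. *)
Definition tent (L j : nat) (y : nat -> bool) : R :=
  \sum_(m < L.+1) dyadic_weight (L - j) m * (bit_change j m y)%:R.

Lemma tent_ge0 L j y : 0 <= tent L j y.
Proof.
by apply: sumr_ge0 => m _; rewrite mulr_ge0 ?ler0n ?dyadic_weight_ge0.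
Qed.

Lemma tent_le1 L j y : tent L j y <= 1.
Proof.
rewrite -(@sum_dyadic_weight1 L (L - j)) ?leq_subr //.
apply: ler_sum => m _; rewrite ler_piMr ?dyadic_weight_ge0 //.
by case: bit_change; rewrite ?ler01.
Qed.

Lemma prod_natr_bool (I : finType) (P : pred I) :
  \prod_(i : I) (P i)%:R = [forall i, P i]%:R :> R.
Proof.
have [/forallP H|] := boolP [forall i, P i].
  by apply: big1 => i _; rewrite H.
rewrite negb_forall => /existsP[i /negbTE Pi].
by rewrite (bigD1 i) //= Pi mul0r.
Qed.

Lemma sum_ord_split (V : nmodType) (m n : nat) (f : nat -> V) :
  \sum_(k < m + n) f k = \sum_(k < m) f k + \sum_(k < n) f (m + k)%N.
Proof. by rewrite big_split_ord. Qed.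

Variables (q : nat -> {poly 'F_2}) (d t L : nat).
Hypothesis q_enum : irreducible_enumeration q.
Hypothesis t_ge : (\sum_(c < 2 * d) (size (base_poly q c)).-1 <= t)%N.
Variables (j : nat -> nat) (a : nat -> nat -> bool).
Let E := interlace (niederreiter q).

Definition box_tent (k : nat) : R :=
  \prod_(i < d) ((agree (j i).-1 (a i) (point_bit E k i))%:R *
                 tent L (j i) (point_bit E k i)).

Definition box_tent_mean : R := \prod_(i < d) (2^-1 ^+ (j i).-1 / 2).

(** The factor 4 ^ d bounds the weighted sums of powers of 3 / 2; the other factor pays for the
    shift by t + 3 d in the independence condition. *)
Definition block_const : R := 4 ^+ d * (9 / 4) ^+ (t + 3 * d).

Let r := (\sum_(i < d) (j i).-1)%N.

Lemma leq_sum_pred : (\sum_(i < d) j i <= r + d)%N.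
Proof.
rewrite /r -[X in (_ + X)%N](card_ord d) -sum1_card -big_split /=.
by apply: leq_sum => i _; case: (j i) => // n; rewrite addn1.
Qed.

Lemma box_tent_meanE : box_tent_mean = 2^-1 ^+ r * 2^-1 ^+ d.
Proof.
rewrite /box_tent_mean big_split /=; congr (_ * _); last first.
  by rewrite prodr_const card_ord.
by rewrite /r expr_sum.
Qed.

Lemma box_tent_ge0 k : 0 <= box_tent k.
Proof. by apply: prodr_ge0 => i _; rewrite mulr_ge0 ?tent_ge0. Qed.

Lemma sum_natr_pred (I : finType) (P : pred I) :
  \sum_(k : I) (P k)%:R = #|[pred k | P k]|%:R :> R.
Proof.
rewrite -sum1_card natr_sum [RHS]big_mkcond; apply: eq_bigr => k _.
by rewrite inE; case: (P k).
Qed.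

Lemma natr_count_half (c e mu : nat) : (c * 2 ^ e = 2 ^ mu)%N ->
  c%:R = 2 ^+ mu * 2^-1 ^+ e :> R.
Proof.
move=> /(congr1 (fun n => n%:R : R)); rewrite natrM !natrX => <-.
by rewrite -mulrA -exprMn divff // expr1n mulr1.
Qed.

Lemma sum_box mu b : (r + t + 3 * d <= mu)%N ->
  \sum_(k < 2 ^ mu)
    [forall i : 'I_d, agree (j i).-1 (a i) (point_bit E (b * 2 ^ mu + k) i)]%:R
  = 2 ^+ mu * 2^-1 ^+ r :> R.
Proof.
move=> rmu; rewrite sum_natr_pred; apply: natr_count_half.
rewrite -[RHS](@block_count q q_enum d t t_ge false mu b j (fun=> 0%N) a).
  congr (_ * 2 ^ _)%N; last by apply: eq_bigr => i _; rewrite addn0.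
  by apply: eq_card => k; rewrite !inE; apply: eq_forallb => i; rewrite andbT.
rewrite (eq_bigr (fun i : 'I_d => 2 * j i)%N); last by move=> i _; rewrite addn0.
have -> : (\sum_(i < d) 2 * j i = 2 * \sum_(i < d) j i)%N by rewrite big_distrr.
by have := leq_sum_pred; move: rmu; lia.
Qed.

Definition nat_fun (f : {ffun 'I_d -> 'I_L.+1}) (i : nat) : nat :=
  if (insub i : option 'I_d) is Some i' then f i' else 0%N.

Lemma nat_funE f (i : 'I_d) : nat_fun f i = f i.
Proof. by rewrite /nat_fun valK. Qed.

Let W (f : {ffun 'I_d -> 'I_L.+1}) : R :=
  \prod_(i < d) dyadic_weight (L - j i) (f i).

Let event (f : {ffun 'I_d -> 'I_L.+1}) (k : nat) : bool :=
  [forall i : 'I_d, agree (j i).-1 (a i) (point_bit E k i) &&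
     bit_change (j i) (nat_fun f i) (point_bit E k i)].

(** Expanding the product of weighted sums gives a convex combination, by [sum_weights], of
    indicators of digit events. *)
Lemma box_tentE k : box_tent k = \sum_f W f * (event f k)%:R.
Proof.
rewrite /box_tent.
under eq_bigr do rewrite /tent big_distrr /=.
rewrite bigA_distr_bigA /=; apply: eq_bigr => f _.
rewrite /event -prod_natr_bool -big_split /=; apply: eq_bigr => i _.
by rewrite nat_funE mulrCA -natrM mulnb.
Qed.

Lemma sum_weights : \sum_f W f = 1.
Proof.
rewrite /W -(bigA_distr_bigA (fun (i : 'I_d) (m : 'I_L.+1) => dyadic_weight (L - j i) m)).
by apply: big1 => i _; rewrite sum_dyadic_weight1 ?leq_subr.
Qed.

Lemma sum_event mu b (f : {ffun 'I_d -> 'I_L.+1}) :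
  (2 * (t + 2 * d) + \sum_(i < d) (2 * j i + f i) <= 2 * mu)%N ->
  \sum_(k < 2 ^ mu) (event f (b * 2 ^ mu + k))%:R = 2 ^+ mu * box_tent_mean.
Proof.
move=> good; rewrite sum_natr_pred box_tent_meanE -exprD; apply: natr_count_half.
rewrite -[RHS](@block_count q q_enum d t t_ge true mu b j (nat_fun f) a).
  congr (_ * 2 ^ _)%N; rewrite big_split /=.
  by rewrite sum1_card card_ord.
by under eq_bigr do rewrite nat_funE.
Qed.

Lemma sum_event_bounds mu b f : (r + t + 3 * d <= mu)%N ->
  0 <= (\sum_(k < 2 ^ mu) (event f (b * 2 ^ mu + k))%:R : R) <= 2 ^+ mu * 2^-1 ^+ r.
Proof.
move=> rmu; rewrite sumr_ge0 //= -(sum_box b rmu); apply: ler_sum => k _.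
rewrite ler_nat; have [/forallP ev|//] := boolP (event f _).
suff -> : [forall i : 'I_d, agree (j i).-1 (a i) (point_bit E (b * 2 ^ mu + k) i)] by [].
by apply/forallP => i; case/andP: (ev i).
Qed.

(* By independence only those f with sum (2 j + f) > 2 (mu - t - 2 d)
   contribute to the error.  Their indicator is dominated by a power of 3/2,
   which the weights 2^-f can absorb. *)
Lemma block_discrepancy mu b : (r + t + 3 * d <= mu)%N ->
  `|\sum_(k < 2 ^ mu) (box_tent (b * 2 ^ mu + k) - box_tent_mean)|
    <= block_const * (8 / 9) ^+ (mu - r).
Proof.
move=> rmu; rewrite sumrB sumr_const card_ord -[_ *+ (2 ^ mu)]mulr_natl natrX.
under eq_bigr do rewrite box_tentE.
rewrite exchange_big /= -[X in _ - X]mul1r -[X in _ - X * _]sum_weights mulr_suml -sumrB.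
apply: le_trans (ler_norm_sum _ _ _) _.
pose B : R := 2 ^+ mu * 2^-1 ^+ r.
pose x (f : {ffun 'I_d -> 'I_L.+1}) := (\sum_(i < d) (2 * j i + f i))%N.
pose y := (2 * (mu - (t + 2 * d)))%N.
have W_ge0 f : 0 <= W f by apply: prodr_ge0 => i _; exact: dyadic_weight_ge0.
have B_ge0 : 0 <= B by rewrite mulr_ge0 ?exprn_ge0.
apply: (@le_trans _ _ (\sum_f W f * (B * ((3 / 2) ^+ x f / (3 / 2) ^+ y)))).
  apply: ler_sum => f _; rewrite -mulr_sumr -mulrBr normrM (ger0_norm (W_ge0 f)).
  apply: ler_wpM2l => //.
  have [good|bad] := leqP (2 * (t + 2 * d) + x f) (2 * mu).
    by rewrite sum_event // subrr normr0 mulr_ge0 ?divr_ge0 ?exprn_ge0.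
  apply: (@le_trans _ _ B).
    have /andP[s0 sB] := sum_event_bounds b f rmu.
    have m0 : 0 <= 2 ^+ mu * box_tent_mean.
      by rewrite box_tent_meanE !mulr_ge0 ?exprn_ge0.
    have mB : 2 ^+ mu * box_tent_mean <= B.
      rewrite box_tent_meanE mulrA ler_piMr //.
      by rewrite exprn_ile1 //; lra.
    by rewrite ler_norml; apply/andP; split; rewrite -/B in sB; lra.
  rewrite ler_peMr // ler_pdivlMr ?exprn_gt0 // mul1r.
  by apply: ler_weXn2l; [lra|rewrite /y; lia].
pose e := (mu - r)%N; pose J := (\sum_(i < d) j i)%N.
have -> : \sum_f W f * (B * ((3 / 2) ^+ x f / (3 / 2) ^+ y)) =
    2 ^+ e * ((9 / 4) ^+ J / (3 / 2) ^+ y) *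
    \prod_(i < d) \sum_(m < L.+1) dyadic_weight (L - j i) m * (3 / 2) ^+ m.
  rewrite bigA_distr_bigA big_distrr /=; apply: eq_bigr => f _.
  rewrite big_split /= -/(W f) -expr_sum /x big_split /= exprD -big_distrr /= exprM.
  have -> : (3 / 2) ^+ 2 = 9 / 4 :> R by field.
  have -> : B = 2 ^+ e.
    rewrite /B -{1}(subnK (_ : r <= mu)%N) ?exprD; last by lia.
    by rewrite -mulrA -exprMn divff // expr1n mulr1.
  by rewrite -/J; ring.
have J_le : (9 / 4) ^+ J / (3 / 2) ^+ y <= (9 / 4) ^+ (t + 3 * d) * (4 / 9) ^+ e :> R.
  rewrite ler_pdivrMr ?exprn_gt0 // /y exprM.
  have -> : (3 / 2) ^+ 2 = 9 / 4 :> R by field.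
  apply: (@le_trans _ _ ((9 / 4) ^+ (r + d))).
    by apply: ler_weXn2l; [lra|exact: leq_sum_pred].
  rewrite mulrAC -exprD.
  have -> : (t + 3 * d + (mu - (t + 2 * d)) = (r + d) + e)%N by rewrite /e; lia.
  rewrite [X in _ <= X * _]exprD -[leRHS]mulrA -exprMn.
  by rewrite (_ : 9 / 4 * (4 / 9) = 1) ?expr1n ?mulr1 //; field.
have prod_le : \prod_(i < d) \sum_(m < L.+1) dyadic_weight (L - j i) m * (3 / 2) ^+ m
    <= 4 ^+ d :> R.
  rewrite -[X in _ <= 4 ^+ X](card_ord d) -prodr_const; apply: ler_prod => i _.
  rewrite sum_dyadic_weight_exp ?leq_subr // andbT; apply: sumr_ge0 => m _.
  by rewrite mulr_ge0 ?dyadic_weight_ge0 ?exprn_ge0.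
rewrite /block_const -/e.
have -> : (8 / 9) ^+ e = 2 ^+ e * (4 / 9) ^+ e :> R.
  by rewrite -exprMn; congr (_ ^+ _); field.
have -> : 4 ^+ d * (9 / 4) ^+ (t + 3 * d) * (2 ^+ e * (4 / 9) ^+ e) =
    2 ^+ e * ((9 / 4) ^+ (t + 3 * d) * (4 / 9) ^+ e) * 4 ^+ d :> R by ring.
apply: ler_pM => //.
- by apply: prodr_ge0 => i _; apply: sumr_ge0 => m _;
    rewrite mulr_ge0 ?dyadic_weight_ge0 ?exprn_ge0.
- by rewrite ler_pM2l ?exprn_gt0.
Qed.

Definition discrepancy_const : R := 9 * block_const + 2 ^+ (t + 3 * d).

(** The lowest binary digit of [c] splits off at most one block of length 2^mu; the rest consists of
    blocks of twice the length. The bounds add up geometrically, and 9 = 1 / (1 - 8 / 9). *)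
Lemma prefix_discrepancy c mu : (r + t + 3 * d <= mu)%N ->
  `|\sum_(k < c * 2 ^ mu) (box_tent k - box_tent_mean)|
    <= 9 * block_const * (8 / 9) ^+ (mu - r).
Proof.
elim/ltn_ind: c mu => c IH mu rmu; pose f k := box_tent k - box_tent_mean.
have K0 : 0 <= block_const by rewrite mulr_ge0 ?exprn_ge0.
have [->|c0] := posnP c.
  by rewrite mul0n big_ord0 normr0 !mulr_ge0 ?exprn_ge0.
have half : `|\sum_(k < c %/ 2 * 2 ^ mu.+1) f k|
    <= 9 * block_const * ((8 / 9) * (8 / 9) ^+ (mu - r)).
  rewrite -exprS -subSn; last by lia.
  by apply: IH; [lia|exact: leqW].
have -> : (c * 2 ^ mu = c %/ 2 * 2 ^ mu.+1 + c %% 2 * 2 ^ mu)%N.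
  by rewrite expnS mulnA -mulnDl -divn_eq.
rewrite (sum_ord_split _ _ f); apply: le_trans (ler_normD _ _) _.
have K1 : 0 <= block_const * (8 / 9) ^+ (mu - r) by rewrite mulr_ge0 ?exprn_ge0.
have [c2|c2] : (c %% 2 = 0 \/ c %% 2 = 1)%N by lia.
  by rewrite c2 mul0n big_ord0 normr0 addr0; lra.
rewrite c2 mul1n; have := block_discrepancy (c %/ 2 * 2) rmu.
by rewrite -mulnA -expnS -/(f _); lra.
Qed.

(* The remainder after the last full block of 2^mu0 points, mu0 = r + t + 3 d,
   stays in a single block, whose points meet the box 2^(t + 3 d) times. *)
Lemma box_tent_discrepancy N :
  `|\sum_(k < N) (box_tent k - box_tent_mean)| <= discrepancy_const.
Proof.
pose mu := (r + t + 3 * d)%N; pose f k := box_tent k - box_tent_mean.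
have mu0 : (0 < 2 ^ mu)%N by rewrite expn_gt0.
rewrite (divn_eq N (2 ^ mu)) (sum_ord_split _ _ f).
apply: le_trans (ler_normD _ _) _; apply: lerD.
  apply: le_trans (prefix_discrepancy _ (leqnn _)) _.
  rewrite ler_piMr ?mulr_ge0 ?exprn_ge0 // exprn_ile1 //; lra.
have Npow : (N %% 2 ^ mu <= 2 ^ mu)%N by rewrite ltnW // ltn_mod.
pose b := (N %/ 2 ^ mu)%N.
have powE : 2 ^+ mu * 2^-1 ^+ r = 2 ^+ (t + 3 * d) :> R.
  rewrite /mu -addnA exprD mulrAC -exprMn divff // expr1n mul1r //.
rewrite sumrB; set S1 := \sum_(k < _) _; set S2 := \sum_(k < _) _.
have S1_ge0 : 0 <= S1 by apply: sumr_ge0 => k _; exact: box_tent_ge0.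
have S1_le : S1 <= 2 ^+ (t + 3 * d).
  rewrite -powE -(sum_box b (leqnn mu)) /S1.
  rewrite (big_ord_widen _ (fun k => box_tent (b * 2 ^ mu + k)) Npow) big_mkcond.
  apply: ler_sum => k _; apply: (@le_trans _ _ (box_tent (b * 2 ^ mu + k))).
    by case: ifP => // _; exact: box_tent_ge0.
  rewrite -prod_natr_bool; apply: ler_prod => i _.
  by rewrite mulr_ge0 ?tent_ge0 // ler_piMr ?tent_le1.
have S2_ge0 : 0 <= S2.
  by apply: sumr_ge0 => k _; rewrite box_tent_meanE mulr_ge0 ?exprn_ge0.
have S2_le : S2 <= 2 ^+ (t + 3 * d).
  rewrite /S2 sumr_const card_ord -powE -[_ *+ (_ %% _)]mulr_natl box_tent_meanE.
  apply: ler_pM => //.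
    by rewrite -natrX ler_nat.
  by rewrite ler_piMr ?exprn_ge0 // exprn_ile1 //; lra.
by rewrite ler_norml; apply/andP; split; lra.
Qed.

End local_discrepancy.

(** * Moments of sums of dyadic differences *)

Section moments.
Variables (R : realFieldType) (Omega : finType) (m : nat).
Implicit Types (f g : Omega -> R) (V W : R).

(** The square of the normalized 2m-norm of [f] is at most [V]. *)
Definition moment_le f V : Prop :=
  \sum_x f x ^+ (2 * m) <= #|Omega|%:R * V ^+ m.

Definition smoothness_const : R := 2 * 4 ^+ m.

Lemma bin_le_exp2 n k : ('C(n, k) <= 2 ^ n)%N.
Proof.
have [kn|nk] := leqP k n; last by rewrite bin_small.
rewrite -[2%N]/(1 + 1)%N expnDn (bigD1 (Ordinal (kn : (k < n.+1)%N))) //=.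
by rewrite !exp1n !muln1 leq_addr.
Qed.

Lemma mulr_exp_le (u v : R) k : 0 <= u -> 0 <= v -> (k <= m)%N ->
  u ^+ (m - k) * v ^+ k <= u ^+ m + v ^+ m.
Proof.
move=> u0 v0 km; have [uv|vu] := leP u v.
  rewrite ler_wpDl ?exprn_ge0 // -[in leRHS](subnK km) exprD.
  by rewrite ler_wpM2r ?exprn_ge0 // lerXn2r.
rewrite ler_wpDr ?exprn_ge0 // -[in leRHS](subnK km) exprD.
by rewrite ler_wpM2l ?exprn_ge0 // lerXn2r // ltW.
Qed.

(** After dividing f^2 by [V] and g^2 by [W], [mulr_exp_le] bounds the product pointwise by a sum of
    two terms, each of mean at most 1. *)
Lemma moment_le_mixed f g V W k : 0 < V -> 0 < W -> moment_le f V ->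
  moment_le g W -> (k <= m)%N ->
  \sum_x f x ^+ (2 * m - 2 * k) * g x ^+ (2 * k) <=
  #|Omega|%:R * (2 * (V ^+ (m - k) * W ^+ k)).
Proof.
move=> V0 W0 fV gW km.
have norm h U : 0 < U -> moment_le h U ->
    \sum_x (h x ^+ 2 / U) ^+ m <= #|Omega|%:R.
  move=> U0 hU; under eq_bigr do rewrite expr_div_n -exprM.
  by rewrite -mulr_suml ler_pdivrMr ?exprn_gt0.
apply: (@le_trans _ _ (\sum_x V ^+ (m - k) * W ^+ k *
    ((f x ^+ 2 / V) ^+ m + (g x ^+ 2 / W) ^+ m))).
  apply: ler_sum => x _; rewrite -mulnBr !exprM.
  rewrite -[f x ^+ 2 in leLHS](divfK (lt0r_neq0 V0)).
  rewrite -[g x ^+ 2 in leLHS](divfK (lt0r_neq0 W0)).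
  rewrite ![(_ / _ * _) ^+ _]exprMn mulrACA [leLHS]mulrC.
  rewrite ler_wpM2l ?mulr_ge0 ?exprn_ge0 ?(ltW V0) ?(ltW W0) //.
  by apply: mulr_exp_le => //; rewrite divr_ge0 ?sqr_ge0 ?(ltW V0) ?(ltW W0).
rewrite -mulr_sumr big_split /= [leRHS]mulrA [leRHS]mulrC.
rewrite ler_wpM2l ?mulr_ge0 ?exprn_ge0 ?(ltW V0) ?(ltW W0) //.
by have := norm _ _ V0 fV; have := norm _ _ W0 gW; lra.
Qed.

(* The terms of odd degree in g cancel under tau.  The constant 2 * 4 ^ m
   absorbs the binomial coefficients and the crude Hoelder inequality of
   moment_le_mixed. *)
Lemma moment_leD (tau : Omega -> Omega) f g V W : injective tau ->
  (forall x, f (tau x) = f x) -> (forall x, g (tau x) = - g x) ->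
  0 < V -> 0 < W -> moment_le f V -> moment_le g W ->
  moment_le (fun x => f x + g x) (V + smoothness_const * W).
Proof.
move=> tau_inj ftau gtau V0 W0 fV gW; rewrite /moment_le.
pose a i := (\sum_x f x ^+ (2 * m - i) * g x ^+ i) *+ 'C(2 * m, i).
have -> : \sum_x (f x + g x) ^+ (2 * m) = \sum_(i < 2 * m.+1) a i.
  under eq_bigr do rewrite exprDn.
  rewrite exchange_big /= mulnS -[(2 + _)%N]/((2 * m).+2) [RHS]big_ord_recr /=.
  rewrite [X in _ = _ + X]/a.
  rewrite bin_small // mulr0n addr0.
  by apply: eq_bigr => i _; rewrite /a sumrMnl.
rewrite (sum_parity m.+1 a) exprDn mulr_sumr; apply: ler_sum => k _.
have km : (k <= m)%N by rewrite -ltnS ltn_ord.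
have -> : a (2 * k + 1)%N = 0.
  have aN : \sum_x f x ^+ (2 * m - (2 * k + 1)) * g x ^+ (2 * k + 1) =
      - \sum_x f x ^+ (2 * m - (2 * k + 1)) * g x ^+ (2 * k + 1).
    rewrite [LHS](reindex_inj tau_inj) /= -sumrN; apply: eq_bigr => x _.
    rewrite ftau gtau exprNn addn1 exprS exprM sqrrN !expr1n !mulr1.
    by rewrite mulN1r mulrN.
  by rewrite /a (_ : \sum_x _ = 0) ?mul0rn //; move: aN; lra.
rewrite addr0 /a; have [k0|k_gt0] := posnP k.
  rewrite k0 !muln0 !bin0 !mulr1n !subn0 expr0 mulr1.
  by under eq_bigr do rewrite expr0 mulr1.
rewrite -[leLHS]mulr_natr.
apply: le_trans (ler_wpM2r _ (moment_le_mixed V0 W0 fV gW km)) _ => //.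
have C_le : 2 * 'C(2 * m, 2 * k)%:R <= smoothness_const ^+ k * 'C(m, k)%:R :> R.
  have K1 : 1 <= smoothness_const.
    have : 1 <= 4 ^+ m :> R by rewrite exprn_ege1 //; lra.
    by rewrite /smoothness_const; lra.
  apply: (@le_trans _ _ (smoothness_const ^+ k)).
    apply: (@le_trans _ _ smoothness_const); last by rewrite -[leLHS]expr1 ler_weXn2l.
    rewrite /smoothness_const ler_pM2l //.
    have -> : 4 ^+ m = (2 ^ (2 * m))%N%:R :> R.
      by rewrite natrX exprM; congr (_ ^+ _); ring.
    by rewrite ler_nat bin_le_exp2.
  by rewrite ler_peMr ?exprn_ge0 ?(le_trans ler01) // ler1n bin_gt0.
have -> : #|Omega|%:R * (2 * (V ^+ (m - k) * W ^+ k)) * 'C(2 * m, 2 * k)%:R =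
    #|Omega|%:R * (V ^+ (m - k) * W ^+ k * (2 * 'C(2 * m, 2 * k)%:R)) by ring.
rewrite ler_wpM2l // exprMn -[_ *+ 'C(m, k)]mulr_natr.
have -> : V ^+ (m - k) * (smoothness_const ^+ k * W ^+ k) * 'C(m, k)%:R =
    V ^+ (m - k) * W ^+ k * (smoothness_const ^+ k * 'C(m, k)%:R) by ring.
by rewrite ler_wpM2l // mulr_ge0 ?exprn_ge0 ?(ltW V0) ?(ltW W0).
Qed.

(** Level n + 1 is odd under [tau n] and all earlier levels are even, so [moment_leD] adds one level
    at the cost of [smoothness_const * V]. The bound grows only linearly in [L]. *)
Lemma moment_le_sum (L : nat) (tau : nat -> Omega -> Omega)
    (h : nat -> Omega -> R) V : 0 < V ->
  (forall l, (l < L)%N -> injective (tau l)) ->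
  (forall l x, (l < L)%N -> h l.+1 (tau l x) = - h l.+1 x) ->
  (forall l l' x, (l' <= l < L)%N -> h l' (tau l x) = h l' x) ->
  (forall l, (l <= L)%N -> moment_le (h l) V) ->
  moment_le (fun x => \sum_(l < L.+1) h l x) ((1 + smoothness_const * L%:R) * V).
Proof.
move=> V0 tau_inj hN h_even hV.
have K0 : 0 <= smoothness_const by rewrite mulr_ge0 ?exprn_ge0.
suff step n : (n <= L)%N ->
    moment_le (fun x => \sum_(l < n.+1) h l x) ((1 + smoothness_const * n%:R) * V).
  exact: step.
elim: n => [|n IH] nL.
  rewrite mulr0 addr0 mul1r; have := hV 0%N (leq0n L).
  by rewrite /moment_le; under [X in _ -> X <= _]eq_bigr do rewrite big_ord1.
have := moment_leD (tau_inj n nL) _ (fun x => hN n x nL) _ V0 (IH (ltnW nL)) (hV n.+1 nL).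
rewrite /moment_le => H.
under eq_bigr do rewrite big_ord_recr /=.
have -> : (1 + smoothness_const * n.+1%:R) * V =
    (1 + smoothness_const * n%:R) * V + smoothness_const * V.
  by rewrite -natr1; ring.
apply: H => [x|].
  by apply: eq_bigr => l _; rewrite h_even // nL andbT -ltnS ltn_ord.
by rewrite mulr_gt0 // ltr_wpDr // mulr_ge0.
Qed.

End moments.

(** * Sums over the levels of all coordinates, one coordinate at a time *)

Section partial_sums.
Variables (R : realFieldType) (L : nat).
Implicit Types F : (nat -> nat) -> R.

Definition update (j : nat -> nat) (n l : nat) : nat -> nat :=
  fun i => if i == n then l else j i.

(** The first [n] entries of [j] are summed out; the later ones remain as parameters for the
    induction on coordinates. *)
Fixpoint partial_sum F (n : nat) (j : nat -> nat) : R :=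
  if n is n'.+1 then \sum_(l < L.+1) partial_sum F n' (update j n' l) else F j.

Lemma partial_sumB F G n j :
  partial_sum (fun j => F j - G j) n j = partial_sum F n j - partial_sum G n j.
Proof.
elim: n j => //= n IH j; rewrite -sumrB.
by apply: eq_bigr => l _; rewrite IH.
Qed.

Lemma partial_sumZ c F n j :
  partial_sum (fun j => c * F j) n j = c * partial_sum F n j.
Proof.
elim: n j => //= n IH j; rewrite mulr_sumr.
by apply: eq_bigr => l _; rewrite IH.
Qed.

Lemma partial_sum_sum (I : finType) (F : I -> (nat -> nat) -> R) n j :
  partial_sum (fun j => \sum_i F i j) n j = \sum_i partial_sum (F i) n j.
Proof.
elim: n j => //= n IH j; rewrite exchange_big /=.
by apply: eq_bigr => l _; rewrite IH.
Qed.

Lemma partial_sum_prod (d : nat) (g : nat -> nat -> R) n j : (n <= d)%N ->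
  partial_sum (fun j => \prod_(i < d) g i (j i)) n j =
  \prod_(i < d) (if (i < n)%N then \sum_(l < L.+1) g i l else g i (j i)).
Proof.
elim: n j => [//|n IH] j nd; rewrite [LHS]/=.
under eq_bigr do rewrite (IH _ (ltnW nd)).
rewrite (bigD1 (Ordinal nd)) //= ltnS leqnn mulr_suml; apply: eq_bigr => l _.
rewrite (bigD1 (Ordinal nd)) //= ltnn /update eqxx; congr (_ * _).
apply: eq_bigr => i; rewrite -val_eqE /= => i_n.
by rewrite ltnS [(i <= n)%N]leq_eqVlt (negbTE i_n).
Qed.

(** Summing over the first [n] coordinates preserves the parity under flips in the others, so
    [moment_le_sum] can be iterated. Each coordinate costs a factor linear in [L], whence the
    exponent d / 2 of the logarithm. *)
Lemma moment_le_partial_sum (Omega : finType) (m d : nat)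
    (tau : nat -> nat -> Omega -> Omega)
    (F : (nat -> nat) -> Omega -> R) (c : R) : 0 < c ->
  (forall i l, (i < d)%N -> (l < L)%N -> injective (tau i l)) ->
  (forall i l j x, (i < d)%N -> (l < L)%N -> j i = l.+1 ->
     F j (tau i l x) = - F j x) ->
  (forall i l j x, (i < d)%N -> (l < L)%N -> (j i <= l)%N ->
     F j (tau i l x) = F j x) ->
  (forall j x, (forall i, (i < d)%N -> (j i <= L)%N) -> `|F j x| <= c) ->
  forall j, moment_le m (fun x => partial_sum (F^~ x) d j)
    ((1 + smoothness_const R m * L%:R) ^+ d * c ^+ 2).
Proof.
move=> c0 tau_inj F_odd F_even F_le.
have K0 : 0 <= smoothness_const R m by rewrite mulr_ge0 ?exprn_ge0.
have oddS n i l j x : (n <= i < d)%N -> (l < L)%N -> j i = l.+1 ->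
    partial_sum (F^~ (tau i l x)) n j = - partial_sum (F^~ x) n j.
  elim: n j => [|n IH] j /andP[ni id] lL jil /=; first exact: F_odd.
  rewrite -sumrN; apply: eq_bigr => l' _; apply: IH => //; first by rewrite ltnW.
  by rewrite /update gtn_eqF.
have evenS n i l j x : (n <= i < d)%N -> (l < L)%N -> (j i <= l)%N ->
    partial_sum (F^~ (tau i l x)) n j = partial_sum (F^~ x) n j.
  elim: n j => [|n IH] j /andP[ni id] lL jil /=; first exact: F_even.
  apply: eq_bigr => l' _; apply: IH => //; first by rewrite ltnW.
  by rewrite /update gtn_eqF.
have bound n j : (n <= d)%N -> (forall i, (n <= i < d)%N -> (j i <= L)%N) ->
    moment_le m (fun x => partial_sum (F^~ x) n j)
      ((1 + smoothness_const R m * L%:R) ^+ n * c ^+ 2).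
  elim: n j => [|n IH] j nd jL /=.
    rewrite mul1r /moment_le -[in leRHS]sum1_card natr_sum mulr_suml.
    apply: ler_sum => x _; rewrite mul1r -exprM -(ger0_norm (exprn_even_ge0 _ _)).
      by rewrite normrX lerXn2r ?nnegrE ?normr_ge0 ?(ltW c0) // F_le // => i id; exact: jL.
    by rewrite oddM.
  rewrite exprS -mulrA.
  apply: (@moment_le_sum _ _ m L (tau n)
    (fun l x => partial_sum (F^~ x) n (update j n l))).
  - by rewrite mulr_gt0 ?exprn_gt0 // ltr_wpDr // mulr_ge0.
  - by move=> l lL; exact: tau_inj.
  - by move=> l x lL; apply: oddS; rewrite ?leqnn //= /update eqxx.
  - move=> l l' x /andP[l'l lL]; apply: evenS; rewrite ?leqnn //=.
    by rewrite /update eqxx.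
  - move=> l lL; apply: IH => [|i /andP[ni id]]; first exact: ltnW.
    rewrite /update; case: eqP => // /eqP i_n; apply: jL.
    by rewrite id andbT ltn_neqAle eq_sym i_n.
by move=> j; apply: bound => // i; rewrite ltnNge andbN.
Qed.

End partial_sums.

(** * The discrepancy on the dyadic grid *)

Section dyadic_levels.
Variables (R : realFieldType) (L : nat).
Implicit Types (a y : nat -> bool).

Lemma agree0 a y : agree 0 a y.
Proof. by apply/forallP => -[]. Qed.

Lemma eq_agree J a a' y : (forall l, (l < J)%N -> a l = a' l) ->
  agree J a y = agree J a' y.
Proof. by move=> aa'; apply: eq_forallb => l; rewrite aa'. Qed.

Lemma agreeS J a y : agree J.+1 a y = agree J a y && (a J == y J).
Proof.
apply/forallP/andP => [H|[/forallP H aJ] l].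
  split; last exact: (H ord_max).
  by apply/forallP => l; exact: (H (widen_ord (leqnSn J) l)).
have [lJ|] := ltnP l J; first exact: (H (Ordinal lJ)).
by move=> Jl; rewrite (_ : val l = J) //; apply/eqP; rewrite eqn_leq Jl -ltnS ltn_ord.
Qed.

Definition bit_value y : R := \sum_(l < L) 2^-1 ^+ l.+1 * (y l)%:R.

(** For J <= L, the fractional part of 2^J times [bit_value]. *)
Definition bit_tail J y : R := \sum_(m < L - J) 2^-1 ^+ m.+1 * (y (J + m)%N)%:R.

Lemma bit_valueE J y : (J <= L)%N ->
  bit_value y = \sum_(l < J) 2^-1 ^+ l.+1 * (y l)%:R + 2^-1 ^+ J * bit_tail J y.
Proof.
move=> JL; pose f l : R := 2^-1 ^+ l.+1 * (y l)%:R.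
have -> : bit_value y = \sum_(l < J + (L - J)) f l by rewrite subnKC.
rewrite (sum_ord_split _ _ f).
congr (_ + _); rewrite mulr_sumr; apply: eq_bigr => m _.
by rewrite mulrA -exprD addnS.
Qed.

Lemma bit_tailS J y : (J < L)%N ->
  bit_tail J y = 2^-1 * ((y J)%:R + bit_tail J.+1 y).
Proof.
move=> JL; rewrite /bit_tail -(subnSK JL) big_ord_recl /= expr1 addn0 mulrDr.
congr (_ + _); rewrite mulr_sumr; apply: eq_bigr => m _.
by rewrite /= exprS addSnnS mulrA.
Qed.

Lemma bit_tail_ge0 J y : 0 <= bit_tail J y.
Proof. by apply: sumr_ge0 => m _; rewrite mulr_ge0 ?exprn_ge0. Qed.

Lemma bit_tail_lt1 J y : bit_tail J y < 1.
Proof.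
apply: (@le_lt_trans _ _ (1 - 2^-1 ^+ (L - J))); last first.
  by rewrite ltrBlDr ltrDl exprn_gt0.
rewrite -sum_half_powers; apply: ler_sum => m _.
by rewrite ler_piMr ?exprn_ge0 //; case: (y _); rewrite ?ler01.
Qed.

(** After a previous bit true the changes are the zeros among the later digits; the last weight then
    counts in full because [y L] is false. *)
Lemma tentE j y : y L = false -> (j <= L)%N ->
  tent R L j y = if prev_bit j y then 1 - bit_tail j y else bit_tail j y.
Proof.
move=> yL jL; rewrite /tent.
rewrite (sum_dyadic_weight (fun m => (bit_change j m y)%:R) (leq_subr _ _)).
rewrite /bit_change.
rewrite subnKC // yL /bit_tail; case: prev_bit => /=; last by rewrite mulr0 addr0.
rewrite mulr1 -[X in _ = X - _](subrK (2^-1 ^+ (L - j))) -sum_half_powers addrAC -sumrB.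
congr (_ + _); apply: eq_bigr => m _.
by case: (y _) => /=; rewrite ?mulr0 ?mulr1 ?subr0 ?subrr.
Qed.

(** For j > 0 this is, up to sign, half a Rademacher function of digit j - 1, the source of the
    oddness of the levels. *)
Definition level_sign j a : R := if j is j'.+1 then (a j')%:R - 2^-1 else 1.

Definition level j a y : R :=
  level_sign j a * ((agree j.-1 a y)%:R * tent R L j y).

Definition level_mean j a : R := level_sign j a * (2^-1 ^+ j.-1 / 2).

Lemma bit_value_agree J a y : (J <= L)%N -> agree J a y ->
  bit_value y - bit_value a = 2^-1 ^+ J * (bit_tail J y - bit_tail J a).
Proof.
move=> JL /forallP ay; rewrite !(bit_valueE _ JL) mulrBr.
have -> : \sum_(l < J) 2^-1 ^+ l.+1 * (a l)%:R =
    \sum_(l < J) 2^-1 ^+ l.+1 * (y l)%:R :> R.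
  by apply: eq_bigr => l _; rewrite (eqP (ay l)).
by ring.
Qed.

(* The sum over j <= J is the conditional expectation, given the first J bits
   of a, of the indicator of bit_value y <= bit_value a. *)
Lemma sum_level_prefix J a y : y L = false -> (J <= L)%N ->
  \sum_(j < J.+1) level j a y =
  if agree J a y then 1 - bit_tail J y else (bit_value y <= bit_value a)%R%:R.
Proof.
move=> yL; elim: J => [|J IH] JL.
  by rewrite big_ord1 /level /= mul1r agree0 mul1r tentE.
rewrite big_ord_recr /= (IH (ltnW JL)) agreeS /level /= tentE //=.
have [ay|nay] := ifPn; last by rewrite /= mul0r mulr0 addr0.
have yE := bit_tailS y JL; have aE := bit_tailS a JL.
have vE := bit_value_agree (ltnW JL) ay.
have p0 : 0 < 2^-1 ^+ J :> R by rewrite exprn_gt0.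
have := bit_tail_ge0 J.+1 y; have := bit_tail_lt1 J.+1 y.
have := bit_tail_ge0 J.+1 a; have := bit_tail_lt1 J.+1 a.
move=> a1 a0 y1 y0 /=; rewrite mul1r.
set T := bit_tail J.+1 y; rewrite -/T in yE y0 y1.
(* The induction step for the values of [a J] and [y J], in this order: equal digits leave the
   comparison to the tail, distinct digits decide it. *)
have id11 : 1 - 2^-1 * (1 + T) + (1 - 2^-1) * (1 - T) = 1 - T by field.
have id10 : 1 - 2^-1 * (0 + T) + (1 - 2^-1) * T = 1 by field.
have id01 : 1 - 2^-1 * (1 + T) + (0 - 2^-1) * (1 - T) = 0 by field.
have id00 : 1 - 2^-1 * (0 + T) + (0 - 2^-1) * T = 1 - T by field.
case: (a J) aE; case: (y J) yE; rewrite ?mulr1n ?mulr0n ?eqxx => yE aE.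
- by rewrite yE.
- have -> : bit_value y <= bit_value a.
    by rewrite -subr_le0 vE pmulr_rle0 //; lra.
  by rewrite yE.
- have -> : (bit_value y <= bit_value a) = false.
    by apply/negbTE; rewrite -ltNge -subr_gt0 vE pmulr_rgt0 //; lra.
  by rewrite yE.
- by rewrite yE.
Qed.

Lemma sum_level a y : y L = false ->
  \sum_(j < L.+1) level j a y = (bit_value y <= bit_value a)%R%:R.
Proof.
move=> yL; rewrite sum_level_prefix //; case: ifP => // ay.
rewrite -subr_le0 (bit_value_agree (leqnn L) ay) /bit_tail subnn !big_ord0.
by rewrite !subr0 mulr0 lexx.
Qed.

Lemma sum_level_mean a :
  \sum_(j < L.+1) level_mean j a = bit_value a + 2^-1 ^+ L.+1.
Proof.
rewrite big_ord_recl {1}/level_mean /= expr0.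
under eq_bigr do rewrite /level_mean /= mulrBl.
rewrite sumrB -mulr_sumr.
have -> : \sum_(l < L) 2^-1 ^+ l / 2 = 1 - 2^-1 ^+ L :> R.
  by rewrite -sum_half_powers; apply: eq_bigr => l _; rewrite exprSr.
have -> : \sum_(l < L) (a l)%:R * (2^-1 ^+ l / 2) = bit_value a.
  by apply: eq_bigr => l _; rewrite exprSr mulrC.
by rewrite exprS; field.
Qed.

Lemma level_sign_norm j a : `|level_sign j a| <= 1.
Proof.
case: j => [|j] /=; first by rewrite normr1.
by case: (a j); rewrite ?mulr1n ?mulr0n ler_norml; apply/andP; split; lra.
Qed.

End dyadic_levels.

(** * Expansion of the grid discrepancy into levels *)

Section discrete_discrepancy.
Variables (R : realFieldType) (d L : nat).
Local Notation Omega := {ffun 'I_d -> L.-tuple bool}.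
Implicit Types (x : Omega).

Definition grid_bits x (i l : nat) : bool :=
  if (insub i : option 'I_d) is Some i' then nth false (x i') l else false.

Lemma grid_bitsE x (i : 'I_d) l : grid_bits x i l = nth false (x i) l.
Proof. by rewrite /grid_bits valK. Qed.

Definition flip (i l : nat) x : Omega :=
  [ffun i' : 'I_d => if i' == i :> nat
    then [tuple tnth (x i') l' (+) (l' == l :> nat) | l' < L] else x i'].

Lemma flipK i l : involutive (flip i l).
Proof.
move=> x; apply/ffunP => i'; rewrite ffunE; case: eqP => [E|nE]; last first.
  by rewrite ffunE (introF eqP nE).
apply: eq_from_tnth => l'.
by rewrite tnth_mktuple ffunE (introT eqP E) tnth_mktuple addbK.
Qed.

Lemma grid_bits_flip i l x i' l' : (l < L)%N -> (i' < d)%N ->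
  grid_bits (flip i l x) i' l' = grid_bits x i' l' (+) ((i' == i) && (l' == l)).
Proof.
move=> lL i'd; rewrite -[i']/(val (Ordinal i'd)) !grid_bitsE ffunE /=.
case: eqP => _; last by rewrite addbF.
have [l'L|Ll'] := ltnP l' L.
  rewrite -[l']/(val (Ordinal l'L)) -!tnth_nth tnth_mktuple //.
rewrite !nth_default ?size_tuple //; case: eqP => // l'l.
by move: Ll'; rewrite l'l leqNgt lL.
Qed.

Lemma level_sign_flip_odd i l x : (l < L)%N -> (i < d)%N ->
  level_sign R l.+1 (grid_bits (flip i l x) i) =
  - level_sign R l.+1 (grid_bits x i).
Proof.
move=> lL id; rewrite /level_sign grid_bits_flip // !eqxx /=.
by case: grid_bits; rewrite ?mulr1n ?mulr0n; lra.
Qed.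

Lemma level_sign_flip_even i l x i' j : (l < L)%N -> (i' < d)%N ->
  (i' == i -> (j <= l)%N) ->
  level_sign R j (grid_bits (flip i l x) i') = level_sign R j (grid_bits x i').
Proof.
case: j => [//|j] lL id jl; rewrite /level_sign grid_bits_flip //.
case: eqP jl => [_ /(_ erefl) jl|_ _]; last by rewrite addbF.
by rewrite (ltn_eqF jl) addbF.
Qed.

Variables (q : nat -> {poly 'F_2}) (t : nat).
Hypothesis q_enum : irreducible_enumeration q.
Hypothesis t_ge : (\sum_(c < 2 * d) (size (base_poly q c)).-1 <= t)%N.
Let E := interlace (niederreiter q).

(** The box of coordinate [i] depends only on the digits below [(j i).-1], so the flip of digit [l]
    can act only through the signs. *)
Lemma box_tent_flip i l j x k : (l < L)%N -> (j i <= l.+1)%N ->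
  box_tent R q d L j (grid_bits (flip i l x)) k =
  box_tent R q d L j (grid_bits x) k.
Proof.
move=> lL jl; apply: eq_bigr => i' _; congr (_%:R * _); congr nat_of_bool.
apply: eq_agree => l' l'j; rewrite grid_bits_flip //.
case: eqP l'j => [->|_ _]; last by rewrite addbF.
move=> l'j; have l'l : (l' < l)%N.
  by apply: leq_trans l'j _; case: (j i) jl.
by rewrite (ltn_eqF l'l) addbF.
Qed.

(* bit_value + 2^-(L+1) is the midpoint of the cell, and the sum of the means of
   the levels. *)
Definition grid_discrepancy (N : nat) x : R :=
  \sum_(k < N) \prod_(i < d)
    (bit_value R L (point_bit E k i) <= bit_value R L (grid_bits x i))%R%:R
  - N%:R * \prod_(i < d) (bit_value R L (grid_bits x i) + 2^-1 ^+ L.+1).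

(** The summand with level [j i] in coordinate [i]: the signs carry its parity, the second factor
    its size. *)
Let F (N : nat) (j : nat -> nat) x : R :=
  (\prod_(i < d) level_sign R (j i) (grid_bits x i)) *
  \sum_(k < N) (box_tent R q d L j (grid_bits x) k - box_tent_mean R d j).

Let FE N j x : F N j x =
  \sum_(k < N) \prod_(i < d) level R L (j i) (grid_bits x i) (point_bit E k i)
  - N%:R * \prod_(i < d) level_mean R (j i) (grid_bits x i).
Proof.
rewrite /F sumrB mulrBr mulr_sumr sumr_const card_ord -[_ *+ N]mulr_natl mulrCA.
congr (_ - _ * _); last by rewrite -big_split.
by apply: eq_bigr => k _; rewrite -big_split.
Qed.

Let F_le N j x : `|F N j x| <= discrepancy_const R d t.
Proof.
rewrite normrM -[leRHS]mul1r; apply: ler_pM => //.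
  rewrite normr_prod; apply: prodr_ile1 => i _.
  by rewrite normr_ge0 level_sign_norm.
exact: box_tent_discrepancy.
Qed.

Lemma discrepancy_const_gt0 : 0 < discrepancy_const R d t.
Proof.
by rewrite ltr_wpDl ?exprn_gt0 // /block_const !mulr_ge0 ?exprn_ge0.
Qed.

(** The condition 2 n <= L kills the digit [L] of the points, as [sum_level] requires; the
    indicators and midpoints then expand into levels. *)
Lemma grid_discrepancy_moment (m n N : nat) : (N <= 2 ^ n)%N -> (2 * n <= L)%N ->
  moment_le m (grid_discrepancy N)
    ((1 + smoothness_const R m * L%:R) ^+ d * discrepancy_const R d t ^+ 2).
Proof.
move=> Nn nL.
have -> : grid_discrepancy N = fun x => partial_sum L ((F N)^~ x) d (fun=> 0%N).
  apply/funext => x.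
  have -> : (F N)^~ x = fun j =>
      \sum_(k < N) \prod_(i < d) level R L (j i) (grid_bits x i) (point_bit E k i)
      - N%:R * \prod_(i < d) level_mean R (j i) (grid_bits x i).
    by apply/funext => j; rewrite FE.
  rewrite partial_sumB partial_sumZ partial_sum_sum; congr (_ - _ * _).
    apply: eq_bigr => k _.
    rewrite (partial_sum_prod L
      (fun i l => level R L l (grid_bits x i) (point_bit E k i))) //.
    apply: eq_bigr => i _; rewrite ltn_ord sum_level //.
    by rewrite (point_bit_eq0 q_enum _ (leq_trans (ltn_ord k) Nn)).
  rewrite (partial_sum_prod L (fun i l => level_mean R l (grid_bits x i))) //.
  by apply: eq_bigr => i _; rewrite ltn_ord sum_level_mean.
apply: (@moment_le_partial_sum R L _ m d flip (F N)).
- exact: discrepancy_const_gt0.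
- by move=> i l _ _; exact: inv_inj (flipK i l).
- move=> i l j x id lL jil; rewrite /F -mulNr.
  congr (_ * _); last by apply: eq_bigr => k _; rewrite box_tent_flip ?jil.
  rewrite (bigD1 (Ordinal id)) //= [in RHS](bigD1 (Ordinal id)) //=.
  rewrite jil level_sign_flip_odd // mulNr; congr (- (_ * _)).
  apply: eq_bigr => i' i'i; rewrite level_sign_flip_even // => /eqP i'E.
  by move: i'i; rewrite -val_eqE /= i'E eqxx.
- move=> i l j x id lL jil; rewrite /F.
  congr (_ * _); last by apply: eq_bigr => k _; rewrite box_tent_flip // leqW.
  by apply: eq_bigr => i' _; rewrite level_sign_flip_even // => /eqP ->.
- by move=> j x _; exact: F_le.
Qed.

End discrete_discrepancy.

(** * From the grid to the cube *)

Section grid_cells.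
Variable R : realType.
Implicit Types y : nat -> bool.

Definition bit_code L y : nat := (\sum_(l < L) y l * 2 ^ (L - l.+1))%N.

Lemma bit_valueE_code L y : bit_value R L y = (bit_code L y)%:R * 2^-1 ^+ L.
Proof.
rewrite /bit_value /bit_code natr_sum mulr_suml; apply: eq_bigr => l _.
rewrite natrM natrX -mulrA mulrC; congr (_ * _).
rewrite -[X in _ * _ ^+ X](subnK (ltn_ord l)) [_ ^+ (_ + _)]exprD mulrA -exprMn divff //.
by rewrite expr1n mul1r.
Qed.

Lemma bit_value_ltP L y y' : bit_value R L y < bit_value R L y' ->
  bit_value R L y + 2^-1 ^+ L <= bit_value R L y'.
Proof.
have p0 : 0 < 2^-1 ^+ L :> R by rewrite exprn_gt0.
rewrite !bit_valueE_code ltr_pM2r // ltr_nat => yy'.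
by rewrite -[X in _ + X]mul1r -mulrDl ler_pM2r // natr1 ler_nat.
Qed.

Lemma bit_value_ge0 L y : 0 <= bit_value R L y.
Proof. by apply: sumr_ge0 => l _; rewrite mulr_ge0 ?exprn_ge0. Qed.

Lemma bit_value_le L y : bit_value R L y + 2^-1 ^+ L <= 1.
Proof.
rewrite -lerBrDr -sum_half_powers; apply: ler_sum => l _.
by rewrite ler_piMr ?exprn_ge0 //; case: (y l); rewrite ?ler01.
Qed.

(** Bisection: the new digit tells whether [u] lies beyond the midpoint of its cell. *)
Lemma bit_value_cell L (u : R) : 0 < u <= 1 ->
  exists y : nat -> bool, bit_value R L y < u <= bit_value R L y + 2^-1 ^+ L.
Proof.
move=> /andP[u0 u1]; elim: L => [|L [y /andP[yu uy]]].
  by exists xpredT; rewrite /bit_value big_ord0 add0r expr0 u0.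
pose w : R := bit_value R L y + 2^-1 ^+ L.+1.
pose y' l := if l == L then w < u else y l.
exists y'.
have -> : bit_value R L.+1 y' = bit_value R L y + 2^-1 ^+ L.+1 * (w < u)%R%:R.
  rewrite /bit_value big_ord_recr /= {2}/y' eqxx; congr (_ + _).
  by apply: eq_bigr => l _; rewrite /y' ltn_eqF.
have p0 : 0 < 2^-1 ^+ L :> R by rewrite exprn_gt0.
case: (ltP w u) => wu; rewrite ?mulr1 ?mulr0 ?addr0; apply/andP; split => //.
by move: uy; rewrite exprS; lra.
Qed.

Lemma prodr_dist_le (I : finType) (f g : I -> R) :
  (forall i, 0 <= f i <= 1) -> (forall i, 0 <= g i <= 1) ->
  `|\prod_i f i - \prod_i g i| <= \sum_i `|f i - g i|.
Proof.
move=> f01 g01.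
suff [] : [/\ 0 <= \prod_i f i <= 1, 0 <= \prod_i g i <= 1 &
  `|\prod_i f i - \prod_i g i| <= \sum_i `|f i - g i|] by [].
elim/big_rec3: _ => [|i c b a _ [/andP[a0 a1] /andP[b0 b1] abc]].
  by rewrite subrr normr0 !ler01 !lexx.
have /andP[fi0 fi1] := f01 i; have /andP[gi0 gi1] := g01 i.
split; rewrite ?mulr_ge0 ?mulr_ile1 //.
have -> : f i * a - g i * b = (f i - g i) * a + g i * (a - b) by ring.
apply: le_trans (ler_normD _ _) _; rewrite !normrM.
rewrite (ger0_norm a0) (ger0_norm gi0); apply: lerD; first by rewrite ler_piMr.
by apply: le_trans abc; rewrite ler_piMl.
Qed.

End grid_cells.

Section points_in_cells.
Variables (R : realType) (d : nat) (q : nat -> {poly 'F_2}).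
Hypothesis q_enum : irreducible_enumeration q.
Let E := interlace (niederreiter q).
Let S := explicit_sequence R d q.

Lemma explicit_sequenceE (k n L : nat) (i : 'I_d) : (k < 2 ^ n)%N ->
  (2 * n <= L)%N -> tnth (S k) i = bit_value R L (point_bit E k i).
Proof.
move=> kn nL; rewrite tnth_mktuple.
have digitE l : (digit_vector (E i) k l : nat) = point_bit E k i l.
  by rewrite /point_bit; case: (digit_vector _ _ _) => -[|[|]].
apply: lim_near_cst => //; near=> M.
pose f l : R := 2^-1 ^+ l.+1 * (point_bit E k i l)%:R.
rewrite /series /= big_mkord /bit_value (@sum_widen0 _ L M f).
- by apply: eq_bigr => l _; rewrite digitE /f exprVn mulrC.
- by near: M; exact: nbhs_infty_ge.
- move=> l Ll; rewrite /f (point_bit_eq0 q_enum _ kn) ?mulr0 //.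
  exact: leq_trans Ll.
Unshelve. all: by end_near.
Qed.

Lemma explicit_sequence_itv k (i : 'I_d) : 0 <= tnth (S k) i < 1.
Proof.
have kk : (k < 2 ^ k)%N by exact: ltn_expl.
rewrite (explicit_sequenceE i kk (leqnn _)) bit_value_ge0 /=.
apply: lt_le_trans (bit_value_le R (2 * k) (point_bit E k i)).
by rewrite ltrDl exprn_gt0.
Qed.

Lemma indic_anchored_box (x y : d.-tuple R) :
  \1_(anchored_box x) y = \prod_(i < d) (0 <= tnth y i < tnth x i)%R%:R :> R.
Proof.
rewrite prod_natr_bool indicE; congr (_%:R); congr nat_of_bool.
apply/idP/forallP => [|H]; first by rewrite inE => H i; exact: H.
by rewrite inE => i; exact: H.
Qed.

Lemma discrepancy0 N (x : d.-tuple R) : (exists i, tnth x i <= 0) ->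
  unit_cube x -> discrepancy S N x = 0.
Proof.
move=> [i xi0] x01; have xiE : tnth x i = 0.
  by apply/eqP; rewrite eq_le xi0; case/andP: (x01 i).
rewrite /discrepancy [X in _ - X](bigD1 i) //= xiE mul0r subr0.
rewrite big1 ?mulr0 // => k _; rewrite indic_anchored_box (bigD1 i) //= xiE.
by rewrite leNgt; case: ltP => //; rewrite mul0r.
Qed.

Variables (L n N : nat).
Hypotheses (Nn : (N <= 2 ^ n)%N) (nL : (2 * n <= L)%N).

(** Open on the left because anchored boxes exclude their upper faces: a grid point is below x
    exactly when it is at most the lower end of the cell of x. *)
Definition cell_side (a : {ffun 'I_d -> L.-tuple bool}) (i : 'I_d) : set R :=
  `]bit_value R L (grid_bits a i), bit_value R L (grid_bits a i) + 2^-1 ^+ L]%classic.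

Definition cell (a : {ffun 'I_d -> L.-tuple bool}) : set (d.-tuple R) :=
  [set x | forall i : 'I_d, cell_side a i (tnth x i)].

Lemma cell_cover (x : d.-tuple R) : unit_cube x -> (forall i, 0 < tnth x i) ->
  exists a, cell a x.
Proof.
move=> x01 x0.
have /choice[y yx] (i : 'I_d) : exists y : nat -> bool,
    bit_value R L y < tnth x i <= bit_value R L y + 2^-1 ^+ L.
  by apply: bit_value_cell; rewrite x0; case/andP: (x01 i).
exists [ffun i => [tuple y i l | l < L]] => i; rewrite /cell_side.
have -> : bit_value R L (grid_bits [ffun i => [tuple y i l | l < L]] i) =
    bit_value R L (y i).
  apply: eq_bigr => l _; congr (_ * _%:R); congr nat_of_bool.
  by rewrite grid_bitsE ffunE -tnth_nth tnth_mktuple.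
by rewrite /= in_itv /= yx.
Qed.

(** The counting parts agree on the cell. The volumes differ by at most d 2^-L, and N <= 2^L. *)
Lemma discrepancy_cell a (x : d.-tuple R) : cell a x ->
  N%:R * `|discrepancy S N x| <= `|grid_discrepancy R q N a| + d%:R.
Proof.
move=> ax.
have xa (i : 'I_d) : bit_value R L (grid_bits a i) < tnth x i <=
    bit_value R L (grid_bits a i) + 2^-1 ^+ L.
  by have := ax i; rewrite /cell_side /= in_itv.
have [->|N0] := posnP N; first by rewrite mul0r addr_ge0.
pose mid (i : 'I_d) : R := bit_value R L (grid_bits a i) + 2^-1 ^+ L.+1.
have -> : N%:R * `|discrepancy S N x| =
    `|grid_discrepancy R q N a + N%:R * (\prod_i mid i - \prod_i tnth x i)|.
  rewrite -[X in X * _](ger0_norm (ler0n R N)) -normrM; congr `|_|.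
  rewrite /discrepancy mulrBr mulrA divff ?pnatr_eq0 ?lt0n_neq0 // mul1r.
  rewrite /grid_discrepancy mulrBr -/(mid _) addrA subrK; congr (_ - _).
  apply: eq_bigr => k _; rewrite indic_anchored_box; apply: eq_bigr => i _.
  have kn : (k < 2 ^ n)%N by exact: leq_trans (ltn_ord k) Nn.
  rewrite (explicit_sequenceE _ kn nL) bit_value_ge0 /=.
  have /andP[x1 x2] := xa i; congr (_%:R); congr nat_of_bool.
  have [ya|ay] := leP (bit_value R L (point_bit E k i))
    (bit_value R L (grid_bits a i)).
    by rewrite (le_lt_trans ya x1).
  by apply/negbTE; rewrite -leNgt; apply: le_trans x2 (bit_value_ltP ay).
apply: le_trans (ler_normD _ _) _; rewrite lerD2l normrM ger0_norm //.
have p0 : 0 < 2^-1 ^+ L :> R by rewrite exprn_gt0.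
have dist i : `|mid i - tnth x i| <= 2^-1 ^+ L.
  have /andP[x1 x2] := xa i.
  by rewrite /mid exprS ler_norml; apply/andP; split; lra.
have prod_le : `|\prod_i mid i - \prod_i tnth x i| <= d%:R * 2^-1 ^+ L.
  apply: le_trans (prodr_dist_le _ _) _.
  - move=> i; have := bit_value_ge0 R L (grid_bits a i).
    have := bit_value_le R L (grid_bits a i).
    by rewrite /mid exprS => *; apply/andP; split; lra.
  - move=> i; have /andP[x1 x2] := xa i; have := bit_value_ge0 R L (grid_bits a i).
    by have := bit_value_le R L (grid_bits a i) => *; apply/andP; split; lra.
  apply: (@le_trans _ _ (\sum_(i < d) 2^-1 ^+ L)); first exact: ler_sum.
  by rewrite sumr_const card_ord mulr_natl.
apply: le_trans (ler_wpM2l (ler0n R N) prod_le) _.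
rewrite mulrCA ler_piMr //.
have N_le : N%:R <= 2 ^+ L :> R.
  by rewrite -natrX ler_nat (leq_trans Nn) // leq_exp2l //; lia.
apply: le_trans (ler_wpM2r (ltW p0) N_le) _.
by rewrite -exprMn divff // expr1n.
Qed.

End points_in_cells.

(** * Power means, measurability and integration over cells *)

Section integration.
Variable R : realType.
Local Notation RR := (measurableTypeR R).

(** The normalized square [w] satisfies w^(p/2) <= 1 if w <= 1, and w^(p/2) <= w^m otherwise, where
    [w] is at most f^2 / W. *)
Lemma power_mean_le (T : finType) (f : T -> R) (m : nat) (V c p : R) :
  0 < V -> 0 <= c -> 0 <= p <= (2 * m)%:R -> moment_le m f V ->
  \sum_x (`|f x| + c) `^ p <= #|T|%:R * (2 * (4 * (V + c ^+ 2)) `^ (p / 2)).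
Proof.
move=> V0 c0 /andP[p0 pm] fV.
have c20 : 0 <= c ^+ 2 by exact: sqr_ge0.
set W := V + c ^+ 2; have W0 : 0 < W by rewrite /W; lra.
have pointwise x : (`|f x| + c) `^ p <=
    (4 * W) `^ (p / 2) * (1 + (f x ^+ 2 / W) ^+ m).
  set w := (`|f x| + c) ^+ 2 / (4 * W).
  have fc0 : 0 <= `|f x| + c by rewrite addr_ge0.
  have w0 : 0 <= w by rewrite divr_ge0 ?sqr_ge0 // mulr_ge0 // ltW.
  have -> : (`|f x| + c) `^ p = (4 * W) `^ (p / 2) * w `^ (p / 2).
    have W4 : 4 * W != 0 by rewrite mulf_neq0 ?lt0r_neq0.
    have W4_ge0 : 0 <= 4 * W by rewrite mulr_ge0 ?ltW.
    rewrite -(powRM _ W4_ge0 w0) /w [4 * W * _]mulrC (divfK W4).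
    by rewrite -powR_mulrn // -powRrM [2 * _]mulrC divfK.
  rewrite ler_wpM2l ?powR_ge0 //.
  have u0 : 0 <= f x ^+ 2 / W by rewrite divr_ge0 ?sqr_ge0 // ltW.
  have [w1|w1] := leP w 1.
    apply: (@le_trans _ _ (1 `^ (p / 2))).
      by rewrite ge0_ler_powR ?nnegrE // divr_ge0.
    by rewrite powR1 lerDl exprn_ge0.
  apply: (@le_trans _ _ (w `^ m%:R)).
    apply: ler_powR; first exact: ltW.
    by rewrite ler_pdivrMr // mulrC -natrM.
  rewrite powR_mulrn // ler_wpDl // lerXn2r ?nnegrE //.
  move: w1; rewrite /w ltr_pdivlMr ?mulr_gt0 // mul1r => w1.
  rewrite ler_pdivrMr ?mulr_gt0 // mulrCA divfK ?lt0r_neq0 //.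
  have f2 : f x ^+ 2 = `|f x| ^+ 2 by rewrite real_normK ?num_real.
  (* This gives (|f| + c)^2 <= 2 f^2 + 2 c^2, and [w1] makes 2 c^2 less than half of the left side,
     so that it is at most 4 f^2. *)
  have sq : 0 <= (`|f x| - c) ^+ 2 by exact: sqr_ge0.
  by move: w1 sq; rewrite f2 /W; nra.
apply: (@le_trans _ _ (\sum_x (4 * W) `^ (p / 2) * (1 + (f x ^+ 2 / W) ^+ m))).
  exact: ler_sum.
rewrite -mulr_sumr big_split /= sumr_const -[X in _ <= _ * X]mulrC mulrCA.
rewrite ler_wpM2l ?powR_ge0 // [leRHS]mulr_natr [leRHS]mulr2n lerD2l.
under eq_bigr do rewrite expr_div_n -exprM.
rewrite -mulr_suml ler_pdivrMr ?exprn_gt0 //; apply: le_trans fV _.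
by rewrite ler_wpM2l // lerXn2r ?nnegrE ?(ltW V0) ?(ltW W0) // /W; lra.
Qed.

Lemma measurable_tuple_box (n : nat) (A : 'I_n -> set RR) :
  (forall i, measurable (A i)) ->
  measurable [set x : n.-tuple RR | forall i, A i (tnth x i)].
Proof.
move=> mA; rewrite (_ : [set x | _] =
    \big[setI/setT]_(i < n) ((@tnth n RR)^~ i @^-1` A i)).
  apply: bigsetI_measurable => i _; rewrite -[X in measurable X]setTI.
  exact: measurable_tnth.
rewrite -bigcap_seq; apply/seteqP; split => x /= h i => [_|]; first exact: h.
by apply: h => /=; rewrite mem_index_enum.
Qed.

Lemma measurable_unit_cube d : measurable (@unit_cube R d : set (d.-tuple RR)).
Proof.
rewrite (_ : @unit_cube R d =
    [set x : d.-tuple RR | forall i, `[0, 1]%classic (tnth x i)]).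
  by apply: (@measurable_tuple_box d (fun=> `[0, 1]%classic)) => i; exact: measurable_itv.
by apply/seteqP; split => x x01 i; have := x01 i; rewrite /= in_itv.
Qed.

Lemma measurable_discrepancy d (S : nat -> d.-tuple R) (N : nat) :
  measurable_fun setT (discrepancy S N : d.-tuple RR -> R).
Proof.
apply: measurable_funB; last first.
  by apply: measurable_prod => i _; exact: measurable_tnth.
apply: measurable_funM; first exact: measurable_cst.
apply: measurable_sum => k.
under eq_fun do rewrite indic_anchored_box.
apply: measurable_prod => i _.
rewrite (_ : (fun x => _) = (fun x => (0 <= tnth (S k) i)%R%:R *
    (\1_(`]tnth (S k) i, +oo[%classic : set RR) \o (fun x => tnth x i)) x)).
  apply: measurable_funM; first exact: measurable_cst.
  apply: measurableT_comp; last exact: measurable_tnth.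
  apply: measurable_indic; exact: measurable_itv.
apply/funext => x; rewrite /= indicE -natrM mulnb; congr (_%:R); congr nat_of_bool.
congr (_ && _); apply/idP/idP; rewrite inE /= in_itv /= ?andbT //.
Qed.

End integration.

Section integral_bound.
Variables (R : realType) (d : nat) (q : nat -> {poly 'F_2}).
Hypothesis q_enum : irreducible_enumeration q.
Local Notation RR := (measurableTypeR R).
Let S := explicit_sequence R d q.
Variables (L n N : nat).
Hypotheses (N_gt0 : (0 < N)%N) (Nn : (N <= 2 ^ n)%N) (nL : (2 * n <= L)%N).
Local Notation Omega := {ffun 'I_d -> L.-tuple bool}.

Lemma measurable_cell (a : Omega) : measurable (cell a : set (d.-tuple RR)).
Proof.
by apply: (@measurable_tuple_box R d (cell_side a)) => i; exact: measurable_itv.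
Qed.

Lemma lebesgue_cell (a : Omega) :
  lebesgue_tuple R d (cell a) = (#|{: Omega}|%:R^-1)%:E.
Proof.
rewrite (@lebesgue_tuple_box R d (cell_side a)); last first.
  by move=> i; exact: measurable_itv.
rewrite (eq_bigr (fun=> (2^-1 ^+ L)%:E)); last first.
  move=> i _; rewrite /cell_side lebesgue_measure_itv /= lte_fin ltrDl exprn_gt0 //.
  by rewrite EFinD addeAC subee ?add0e.
rewrite prodEFin prodr_const card_ord; congr (_%:E).
by rewrite card_ffun card_ord card_tuple card_bool !natrX !exprVn.
Qed.

(** The integrand is dominated by a step function on the cells, which all have the same measure.
    Where a coordinate is 0, the discrepancy vanishes, and so does its power since 0 < p. *)
Lemma integral_discrepancy_le (p : R) : 0 < p ->
  (\int[lebesgue_tuple R d]_(x in @unit_cube R d)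
      (`|discrepancy S N x| `^ p)%:E <=
   (#|{: Omega}|%:R^-1 * (N%:R^-1 `^ p *
     \sum_(a : Omega) (`|grid_discrepancy R q N a| + d%:R) `^ p))%:E)%E.
Proof.
move=> p0; pose c (a : Omega) := N%:R^-1 `^ p * (`|grid_discrepancy R q N a| + d%:R) `^ p.
have c0 a : 0 <= c a by rewrite mulr_ge0 ?powR_ge0.
have mcube := @measurable_unit_cube R d.
have mind (a : Omega) : measurable_fun (@unit_cube R d : set (d.-tuple RR))
    (fun x => (\1_(cell a) x : R)%:E).
  by apply/measurable_EFinP; apply: measurable_indic; exact: measurable_cell.
have mterm (a : Omega) : measurable_fun (@unit_cube R d : set (d.-tuple RR))
    (fun x => (c a)%:E * (\1_(cell a) x : R)%:E)%E.
  apply: emeasurable_funM => //.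
apply: (@le_trans _ _ (\int[lebesgue_tuple R d]_(x in @unit_cube R d)
    (\sum_(a : Omega) (c a)%:E * (\1_(cell a) x)%:E)))%E.
  apply: ge0_le_integral => //.
  - apply/measurable_EFinP; apply: measurable_funTS.
    apply: (measurableT_comp (measurable_powR p)).
    apply: measurableT_comp; first exact: normr_measurable.
    exact: measurable_discrepancy.
  - exact: emeasurable_sum.
  - move=> x x01.
    have term0 a : (0 <= (c a)%:E * (\1_(cell a) x : R)%:E)%E.
      by rewrite mule_ge0 // lee_fin.
    have [x_pos|/existsNP[i /negP]] := pselect (forall i, 0 < tnth x i).
      have [a xa] := cell_cover L x01 x_pos.
      rewrite (bigD1 a) //= -[leLHS]adde0; apply: leeD; last exact: sume_ge0.
      rewrite indicE mem_set // mule1 lee_fin /c -powRM ?addr_ge0 ?invr_ge0 //.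
      rewrite ge0_ler_powR ?nnegrE ?mulr_ge0 ?invr_ge0 ?addr_ge0 ?(ltW p0) //.
      rewrite ler_pdivlMl ?ltr0n //.
      exact: (discrepancy_cell q_enum Nn nL).
    rewrite -leNgt => xi0; rewrite discrepancy0 //; last by exists i.
    by rewrite normr0 powR0 ?gt_eqF //; exact: sume_ge0.
rewrite ge0_integral_sum //; last first.
  by move=> a x _; rewrite mule_ge0 // lee_fin.
rewrite (eq_bigr (fun a =>
  (c a)%:E * lebesgue_tuple R d (cell a `&` @unit_cube R d)))%E; last first.
  move=> a _; rewrite ge0_integralZl_EFin // integral_indic //.
  exact: measurable_cell.
apply: (@le_trans _ _ (\sum_(a : Omega) (c a)%:E * (#|{: Omega}|%:R^-1)%:E))%E.
  apply: lee_sum => a _; rewrite -(lebesgue_cell a).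
  apply: lee_wpmul2l; first by rewrite lee_fin.
  apply: le_measure; rewrite ?inE; last exact: subIsetl.
    by apply: measurableI => //; exact: measurable_cell.
  exact: measurable_cell.
rewrite -ge0_sume_distrl; last by move=> a _; rewrite lee_fin.
by rewrite sumEFin -EFinM lee_fin [leLHS]mulrC /c -mulr_sumr.
Qed.

End integral_bound.

Lemma Lp_discrepancy_le (R : realType) (d t m n N : nat)
    (q : nat -> {poly 'F_2}) (p : R) :
  irreducible_enumeration q ->
  (\sum_(c < 2 * d) (size (base_poly q c)).-1 <= t)%N ->
  (0 < N <= 2 ^ n)%N -> 1 <= p <= (2 * m)%:R ->
  (Lp_discrepancy p (@explicit_sequence R d q) N <=
    (2 * (4 * ((1 + smoothness_const R m * (2 * n)%:R) ^+ d *
                 discrepancy_const R d t ^+ 2 + d%:R ^+ 2)) `^ 2^-1 / N%:R)%:E)%E.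
Proof.
move=> q_enum t_ge /andP[N0 Nn] /andP[p1 pm]; have p0 : 0 < p by lra.
set V := _ ^+ d * _.
have K0 : 0 <= smoothness_const R m by rewrite mulr_ge0 ?exprn_ge0.
have V0 : 0 < V.
  rewrite mulr_gt0 ?exprn_gt0 ?discrepancy_const_gt0 //.
  by rewrite ltr_wpDr // mulr_ge0.
have moment := grid_discrepancy_moment R q_enum t_ge m Nn (leqnn (2 * n)).
have p_le : 0 <= p <= (2 * m)%:R by rewrite (ltW p0).
have mean := power_mean_le V0 (ler0n R d) p_le moment.
have int_le := integral_discrepancy_le d q_enum N0 Nn (leqnn (2 * n)) p0.
set W := 4 * (V + _); have W0 : 0 <= W.
  by rewrite mulr_ge0 // addr_ge0 ?sqr_ge0 // ltW.
rewrite -/W in mean; clearbody W.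
have Ni0 : 0 <= N%:R^-1 :> R by rewrite invr_ge0.
apply: (@le_trans _ _ ((N%:R^-1 `^ p * (2 * W `^ (p / 2)))%:E `^ p^-1)%E).
  apply: gt0_ler_poweR; rewrite ?invr_ge0 ?(ltW p0) //.
  - rewrite in_itv /= leey andbT; apply: integral_ge0 => x _.
    by rewrite lee_fin powR_ge0.
  - by rewrite in_itv /= leey andbT lee_fin !mulr_ge0 ?powR_ge0.
  apply: le_trans int_le _; rewrite lee_fin mulrCA ler_wpM2l ?powR_ge0 //.
  have cardT : 0 < #|{: {ffun 'I_d -> (2 * n).-tuple bool}}|%:R :> R.
    by rewrite ltr0n card_ffun expn_gt0 card_tuple expn_gt0 card_bool.
  by rewrite ler_pdivrMl.
rewrite poweR_EFin lee_fin !powRM ?powR_ge0 ?mulr_ge0 ?powR_ge0 //.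
rewrite -!powRrM divff ?gt_eqF // powRr1 // mulrAC divff ?gt_eqF // mul1r.
rewrite [leRHS]mulrC ler_wpM2l // ler_wpM2r ?powR_ge0 //.
(* Here p >= 1 gives 2^(1/p) <= 2. *)
by rewrite ler1_powR ?ler1n // invf_le1.
Qed.

Theorem theorem1p1 (R : realType) (d : nat) (d_gt0 : (0 < d)%N) :
  [/\ exists q : nat -> {poly 'F_2}, irreducible_enumeration q,
      forall q : nat -> {poly 'F_2}, irreducible_enumeration q ->
        forall (k : nat) (j : 'I_d),
          0 <= tnth (@explicit_sequence R d q k) j < 1
    & forall p : R, 1 <= p ->
        exists2 C : R, 0 < C &
          forall q : nat -> {poly 'F_2}, irreducible_enumeration q ->
            forall N : nat, (2 <= N)%N ->
              (Lp_discrepancy p (@explicit_sequence R d q) N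
               <= (C * (ln N%:R `^ (d%:R / 2)) / N%:R)%:E)%E].
Proof.
split; first exact: irreducible_enumeration_exists.
  by move=> q q_enum k j; exact: explicit_sequence_itv.
move=> p p1; have p0 : 0 <= p by lra.
(* A reference enumeration fixes [t], so that the constant does not depend on [q]. *)
have [q0 q0_enum] := irreducible_enumeration_exists.
pose t := (\sum_(c < 2 * d) (size (base_poly q0 c)).-1)%N.
pose m := Num.bound p.
have pm : 1 <= p <= (2 * m)%:R.
  rewrite p1 /=; apply: le_trans (ltW (archi_boundP p0)) _.
  by rewrite ler_nat leq_pmull.
pose K : R := smoothness_const R m.
pose c : R := discrepancy_const R d t.
have K0 : 0 <= K by rewrite mulr_ge0 ?exprn_ge0.
have c0 : 0 < c := discrepancy_const_gt0 R d t.
have ln2 : 0 < ln 2 :> R by rewrite ln_gt0 // ltr1n.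
pose B : R := 4 * ((1 + 4 * K) ^+ d * c ^+ 2 + d%:R ^+ 2).
have B0 : 0 < B.
  have : 0 < (1 + 4 * K) ^+ d * c ^+ 2 by rewrite mulr_gt0 ?exprn_gt0 //; lra.
  by have := sqr_ge0 (d%:R : R); rewrite /B; lra.
(* The powers of 1 / ln 2 convert the base 2 logarithm [l] into the natural one. *)
exists (2 * B `^ 2^-1 * (ln 2)^-1 `^ (d%:R / 2)).
  by rewrite !mulr_gt0 ?powR_gt0 ?invr_gt0.
move=> q q_enum N N2.
have t_ge : (\sum_(c < 2 * d) (size (base_poly q c)).-1 <= t)%N.
  apply: leq_sum => -[[|i] _] _ //=; rewrite -!subn1 leq_sub2r //.
  exact: irreducible_enumeration_size.
(* Then N < 2^n, and n <= 2 l because l >= 1 for N >= 2. *)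
pose n := (trunc_log 2 N).+1.
have N0 : (0 < N)%N by exact: ltnW.
have Nn : (0 < N <= 2 ^ n)%N by rewrite N0 ltnW // trunc_log_ltn.
apply: le_trans (Lp_discrepancy_le q_enum t_ge Nn pm) _.
rewrite lee_fin -/K -/c; clearbody K c.
rewrite ler_pM2r ?invr_gt0 ?ltr0n // -!mulrA ler_pM2l //.
pose l : R := ln N%:R / ln 2.
have lnN : ln 2 <= ln N%:R :> R by rewrite ler_ln ?posrE ?ltr0n ?ler_nat.
have l1 : 1 <= l by rewrite ler_pdivlMr // mul1r.
have n_le : n%:R <= 2 * l.
  suff : (trunc_log 2 N)%:R <= l by rewrite /n -natr1; lra.
  rewrite ler_pdivlMr // mulr_natl -lnXn // ler_ln ?posrE ?exprn_gt0 ?ltr0n //.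
  by rewrite -natrX ler_nat trunc_logP.
have lE : l `^ (d%:R / 2) = (ln 2)^-1 `^ (d%:R / 2) * ln N%:R `^ (d%:R / 2).
  rewrite /l powRM ?invr_ge0 ?(ltW ln2) ?(le_trans (ltW ln2)) //.
  by rewrite mulrC.
rewrite -lE.
have -> : l `^ (d%:R / 2) = (l ^+ d) `^ 2^-1.
  by rewrite -powR_mulrn ?(le_trans ler01) // -powRrM.
rewrite -powRM ?(ltW B0) ?exprn_ge0 ?(le_trans ler01) //.
have K_le : 1 + K * (2 * n)%:R <= (1 + 4 * K) * l.
  rewrite natrM; apply: (@le_trans _ _ (1 + K * (2 * (2 * l)))).
    by rewrite lerD2l ler_wpM2l // ler_wpM2l.
  by have := l1; lra.
have K1 : 0 <= 1 + K * (2 * n)%:R by rewrite addr_ge0 ?mulr_ge0.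
have ld1 : 1 <= l ^+ d by rewrite exprn_ege1.
apply: ge0_ler_powR; rewrite ?nnegrE ?invr_ge0 //.
- by rewrite mulr_ge0 // addr_ge0 ?sqr_ge0 ?mulr_ge0 ?exprn_ge0 ?(ltW c0).
- by rewrite mulr_ge0 ?(ltW B0) ?exprn_ge0 // (le_trans ler01).
(* The summand d^2 is absorbed by l^d >= 1, the other one by [K_le]. *)
rewrite /B -[leRHS]mulrA ler_pM2l // [leRHS]mulrDl; apply: lerD; last first.
  by rewrite ler_peMr ?sqr_ge0.
rewrite mulrAC ler_wpM2r ?sqr_ge0 // -exprMn lerXn2r ?nnegrE //.
by rewrite mulr_ge0 ?(le_trans ler01 l1) //; lra.
Qed.
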